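(* Assume that $H$ is a Gorenstein ring. Let $i:\mathcal{C}(G)\to\mathrm{Rep}^\infty_k(G)$ denote the inclusion. The composed functor $$\mathrm{Ho}(\mathcal{C}(G))\xrightarrow{\mathrm{Ho}(i)}\mathrm{Ho}(\mathrm{Rep}^\infty_k(G))\xrightarrow{RU}\mathrm{Ho}(\mathrm{Mod}(H))$$ induced by the fully faithful functor $\mathcal{C}(G)\xrightarrow{i}\mathrm{Rep}_k^\infty(G)\xrightarrow{U}\mathrm{Mod}(H)$ is an equivalence of categories with inverse $\mathrm{Ho}(\mathbb{F})\,\mathrm{Ho}(Q)$.
   Context: Let $k$ be a field of characteristic $p>0$ and $G$ a topological group (possibly discrete) admitting an open pro-$p$ subgroup $I$. $\mathrm{Rep}_k^\infty(G)$ is the category of smooth $k$-linear $G$-representations (stabilizers of vectors are open). $\mathbb{X}=\mathrm{ind}_I^G(k)$ is the space of compactly supported $f:G\to k$ with $f(gi)=f(g)$ for $i\in I$, with action $(gf)(g')=f(g^{-1}g')$; $H=\mathrm{End}_G(\mathbb{X})^{\mathrm{op}}$; $\mathrm{Mod}(H)$ is the category of left $H$-modules. There is an adjunction $F:\mathrm{Mod}(H)\rightleftarrows\mathrm{Rep}^\infty_k(G):U$, $FM=\mathbb{X}\otimes_HM$, $UV=V^I$, extended termwise to chain complexes. A ring is Gorenstein if it is left and right noetherian with finite injective dimension as a left and right module over itself. An $H$-module $M$ is Gorenstein projective if $M=\ker(d_0)=\mathrm{im}(d_1)$ for an acyclic complex $(Y_\bullet,d_\bullet)$ of projectives which stays exact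 under $\mathrm{Hom}_H(\cdot,P)$ for all projective $P$; $\mathrm{GProj}(H)$ is the full subcategory of these. $\mathrm{Mod}(H)$ carries the Gorenstein projective model structure: cofibrations are the monomorphisms with Gorenstein projective cokernel, fibrations are the epimorphisms, trivial objects are the modules of finite projective dimension; weak equivalences are the composites of a monomorphism with projective cokernel followed by an epimorphism with kernel of finite projective dimension. $Q:\mathrm{Mod}(H)\to\mathrm{GProj}(H)$ is its cofibrant replacement functor. $\mathrm{Rep}^\infty_k(G)$ carries the right transferred model structure: $f$ is a fibration (resp. weak equivalence) iff $Uf$ is one in $\mathrm{Mod}(H)$, and cofibrations are the maps with the left lifting property against trivial fibrations. $RU$ is the right derived functor of $U$. A $G$-representation is $I$-projective if it is a direct summand of $FP$ for a projective $H$-module $P$. A sequence $V_1\to V_2\to V_3$ is $I$-exact if it is a complex and becomes exact after applying $U$. $\mathcal{C}(G)$ is the full subcategory of $\mathrm{Rep}^\infty_k(G)$ of representations isomorphic to $B_0X=\mathrm{im}(X_1\to X_0)$ for some $I$-exact (unbounded) complex $X$ of $I$-projective representations. With the short $I$-exact sequences as admissible exact sequences, $\mathcal{C}(G)$ is a weakly idempotent complete Frobenius category, and carries the unique exact model structure (i.e. admissible monomorphisms are the cofibrations, admissible epimorphisms are the fibrations) in which all objects are fibrant and cofibrant and the trivial objects are the projective objects. A morphism $f$ in $\mathcal{C}(G)$ is a weak equivalence iff $Uf$ is a weak equivalence in $\mathrm{Mod}(H)$; in particular $i$ preserves weak equivalences. $\mathrm{Ho}$ of a category with weak equivalences is the localization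 at the weak equivalences (for $\mathrm{GProj}(H)$, at the weak equivalences of $\mathrm{Mod}(H)$), and $\mathrm{Ho}(\Phi)$ is the functor induced by a functor $\Phi$ preserving weak equivalences. Functorial factorizations in $\mathrm{Mod}(H)$ yield a (fixed) functor $M\mapsto Y^M$ from $\mathrm{Mod}(H)$ to chain complexes of $H$-modules such that $Y^M$ is acyclic with $B_0Y^M=Z_0Y^M=M$ (where $B_0=\mathrm{im}(d_1)$, $Z_0=\ker(d_0)$), $Y^M_i$ is projective for $i\ge1$ and of finite projective dimension for $i\le0$, and $M$ is Gorenstein projective iff all $Y_i^M$ are projective. Put $\mathbb{F}M=B_0FY^M$; here $\mathbb{F}$ is regarded as a functor $\mathrm{GProj}(H)\to\mathcal{C}(G)$. *)

(* Defs.v *)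
From HB Require Import structures.
From mathcomp Require Import all_boot all_order all_algebra monoid.
From mathcomp Require Import boolp classical_sets functions cardinality fsbigop.
From mathcomp Require Import topology generic_quotient.

Set Implicit Arguments.
Unset Strict Implicit.
Unset Printing Implicit Defensive.

Import GRing.Theory.
Local Open Scope classical_set_scope.
Local Open Scope ring_scope.
Local Open Scope quotient_scope.

(** * Categories

  Hom-types carry an equivalence relation [heq], and all equations between
  morphisms are up to [heq].  This avoids quotients in the construction of
  localizations. *)

Record category := Category {
  ob :> Type;
  hom : ob -> ob -> Type;
  heq : forall x y, hom x y -> hom x y -> Prop;
  idm : forall x, hom x x;
  comp : forall x y z, hom y z -> hom x y -> hom x z;
  heq_refl : forall x y (f : hom x y), heq f f;
  heq_sym : forall x y (f g : hom x y), heq f g -> heq g f;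
  heq_trans : forall x y (f g h : hom x y), heq f g -> heq g h -> heq f h;
  comp_heq : forall x y z (g g' : hom y z) (f f' : hom x y),
    heq g g' -> heq f f' -> heq (comp g f) (comp g' f');
  comp1m : forall x y (f : hom x y), heq (comp (idm y) f) f;
  compm1 : forall x y (f : hom x y), heq (comp f (idm x)) f;
  compA : forall x y z t (h : hom z t) (g : hom y z) (f : hom x y),
    heq (comp h (comp g f)) (comp (comp h g) f) }.

Arguments hom {_} _ _.
Arguments heq {_ _ _} _ _.
Arguments idm {_} _.
Arguments comp {_ _ _ _} _ _.

Notation "f =h g" := (heq f g) (at level 70, no associativity).
Notation "g \c f" := (comp g f) (at level 50, left associativity).

Record functor (C D : category) := Functor {
  fob :> C -> D;
  fmap : forall x y, hom x y -> hom (fob x) (fob y);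
  fmap_heq : forall x y (f g : hom x y), f =h g -> fmap f =h fmap g;
  fmap1 : forall x, fmap (idm x) =h idm (fob x);
  fmapM : forall x y z (g : hom y z) (f : hom x y),
    fmap (g \c f) =h fmap g \c fmap f }.

Arguments fmap {C D} _ {x y} _.

Program Definition fid (C : category) : functor C C :=
  @Functor C C (fun x => x) (fun x y f => f) _ _ _.
Next Obligation. by []. Qed.
Next Obligation. by move=> *; apply: heq_refl. Qed.
Next Obligation. by move=> *; apply: heq_refl. Qed.

Program Definition fcomp (C D E : category) (G : functor D E) (F : functor C D)
    : functor C E :=
  @Functor C E (fun x => G (F x)) (fun x y f => fmap G (fmap F f)) _ _ _.
Next Obligation. by move=> C D E G F x y f g fg; do 2 apply: fmap_heq. Qed.
Next Obligation.
move=> C D E G F x; apply: heq_trans (fmap1 _ _); apply: fmap_heq; exact: fmap1.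
Qed.
Next Obligation.
move=> C D E G F x y z g f; apply: heq_trans (fmapM _ _ _).
by apply: fmap_heq; exact: fmapM.
Qed.

Notation "G \of F" := (fcomp G F) (at level 50, left associativity).

Record nat_trans (C D : category) (F G : functor C D) := NatTrans {
  nt :> forall x, hom (F x) (G x);
  nt_nat : forall x y (f : hom x y), nt y \c fmap F f =h fmap G f \c nt x }.

Definition is_iso (C : category) (x y : C) (f : hom x y) :=
  exists g : hom y x, g \c f =h idm x /\ f \c g =h idm y.

Definition isomorphic (C : category) (x y : C) :=
  exists f : hom x y, is_iso f.

Definition nat_isomorphic (C D : category) (F G : functor C D) :=
  exists t : nat_trans F G, forall x, is_iso (t x).

Definition equivalence_with_inverse (C D : category)
    (F : functor C D) (G : functor D C) :=
  nat_isomorphic (G \of F) (fid C) /\ nat_isomorphic (F \of G) (fid D).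

Definition fully_faithful (C D : category) (F : functor C D) :=
  forall x y : C,
    (forall f g : hom x y, fmap F f =h fmap F g -> f =h g) /\
    (forall h : hom (F x) (F y), exists f : hom x y, fmap F f =h h).

Section FullSubcategory.
Variables (C : category) (P : C -> Prop).

Program Definition full_sub : category :=
  @Category {x : C | P x} (fun x y => hom (sval x) (sval y))
    (fun _ _ f g => f =h g) (fun x => idm (sval x)) (fun _ _ _ g f => g \c f)
    _ _ _ _ _ _ _.
Next Obligation. by move=> *; apply: heq_refl. Qed.
Next Obligation. by move=> *; apply: heq_sym. Qed.
Next Obligation. by move=> /= *; apply: heq_trans; eassumption. Qed.
Next Obligation. by move=> *; apply: comp_heq. Qed.
Next Obligation. by move=> *; apply: comp1m. Qed.
Next Obligation. by move=> *; apply: compm1. Qed.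
Next Obligation. by move=> *; apply: compA. Qed.

Program Definition inclusion : functor full_sub C :=
  @Functor full_sub C (fun x => sval x) (fun _ _ f => f) _ _ _.
Next Obligation. by []. Qed.
Next Obligation. by move=> *; apply: heq_refl. Qed.
Next Obligation. by move=> *; apply: heq_refl. Qed.

Program Definition corestrict (B : category) (F : functor B C)
    (FP : forall x, P (F x)) : functor B full_sub :=
  @Functor B full_sub (fun x => exist _ (F x) (FP x)) (fun _ _ f => fmap F f)
    _ _ _.
Next Obligation. by move=> *; apply: fmap_heq. Qed.
Next Obligation. by move=> *; apply: fmap1. Qed.
Next Obligation. by move=> *; apply: fmapM. Qed.

End FullSubcategory.

(** ** Localization

  [Ho W] is the category freely generated by the morphisms of [C] and formal
  inverses of those in [W], subject to the relations of [C]. *)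

Definition mor_class (C : category) := forall x y : C, hom x y -> Prop.

Section Localization.
Variables (C : category) (W : mor_class C).

Inductive zigzag : C -> C -> Type :=
| Zid x : zigzag x x
| Zcomp x y z : zigzag y z -> zigzag x y -> zigzag x z
| Zmor x y : hom x y -> zigzag x y
| Zinv x y (w : hom x y) : W w -> zigzag y x.

Inductive zigzag_eq : forall x y, zigzag x y -> zigzag x y -> Prop :=
| Zrefl x y (a : zigzag x y) : zigzag_eq a a
| Zsym x y (a b : zigzag x y) : zigzag_eq a b -> zigzag_eq b a
| Ztrans x y (a b c : zigzag x y) :
    zigzag_eq a b -> zigzag_eq b c -> zigzag_eq a c
| Zcongr x y z (b b' : zigzag y z) (a a' : zigzag x y) :
    zigzag_eq b b' -> zigzag_eq a a' -> zigzag_eq (Zcomp b a) (Zcomp b' a')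
| Z1m x y (a : zigzag x y) : zigzag_eq (Zcomp (Zid y) a) a
| Zm1 x y (a : zigzag x y) : zigzag_eq (Zcomp a (Zid x)) a
| ZA x y z t (c : zigzag z t) (b : zigzag y z) (a : zigzag x y) :
    zigzag_eq (Zcomp c (Zcomp b a)) (Zcomp (Zcomp c b) a)
| Zmor_heq x y (f g : hom x y) : f =h g -> zigzag_eq (Zmor f) (Zmor g)
| Zmor1 x : zigzag_eq (Zmor (idm x)) (Zid x)
| ZmorM x y z (g : hom y z) (f : hom x y) :
    zigzag_eq (Zmor (g \c f)) (Zcomp (Zmor g) (Zmor f))
| ZinvK x y (w : hom x y) (Ww : W w) :
    zigzag_eq (Zcomp (Zinv Ww) (Zmor w)) (Zid x)
| ZKinv x y (w : hom x y) (Ww : W w) :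
    zigzag_eq (Zcomp (Zmor w) (Zinv Ww)) (Zid y).

Definition Ho : category :=
  @Category C zigzag zigzag_eq Zid Zcomp Zrefl Zsym Ztrans Zcongr Z1m Zm1 ZA.

Definition Ho_loc : functor C Ho :=
  @Functor C Ho (fun x => x) Zmor Zmor_heq Zmor1 ZmorM.

End Localization.

Definition preserves (C D : category) (W : mor_class C) (W' : mor_class D)
    (F : functor C D) :=
  forall x y (w : hom x y), W x y w -> W' _ _ (fmap F w).

Section HoFunctor.
Variables (C D : category) (W : mor_class C) (W' : mor_class D).
Variables (F : functor C D) (FW : preserves W W' F).

Fixpoint Ho_mor x y (a : zigzag W x y) : zigzag W' (F x) (F y) :=
  match a in zigzag _ x y return zigzag W' (F x) (F y) with
  | Zid x => Zid W' (F x)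
  | Zcomp _ _ _ b a => Zcomp (Ho_mor b) (Ho_mor a)
  | Zmor _ _ f => Zmor W' (fmap F f)
  | Zinv _ _ _ Ww => Zinv (FW Ww)
  end.

Lemma Ho_mor_eq x y (a b : zigzag W x y) :
  zigzag_eq a b -> zigzag_eq (Ho_mor a) (Ho_mor b).
Proof.
elim=> {x y a b} //=.
- by move=> *; apply: Zrefl.
- by move=> *; apply: Zsym.
- by move=> *; apply: Ztrans; eassumption.
- by move=> *; apply: Zcongr.
- by move=> *; apply: Z1m.
- by move=> *; apply: Zm1.
- by move=> *; apply: ZA.
- by move=> *; apply: Zmor_heq; apply: fmap_heq.
- by move=> x; apply: Ztrans (Zmor_heq _ (fmap1 F x)) (Zmor1 _ _).
- by move=> *; apply: Ztrans (Zmor_heq _ (fmapM F _ _)) (ZmorM _ _ _).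
- by move=> *; apply: ZinvK.
- by move=> *; apply: ZKinv.
Qed.

Definition Ho_functor : functor (Ho W) (Ho W') :=
  @Functor (Ho W) (Ho W') F Ho_mor Ho_mor_eq
    (fun x => Zrefl (Zid W' (F x))) (fun _ _ _ b a => Zrefl _).

End HoFunctor.

(** The total right derived functor of [F] is the left Kan extension along
  [Ho_loc W] of the composite of [F] with the localization of its target. *)
Record right_derived_functor (C D : category) (W : mor_class C)
    (W' : mor_class D) (F : functor C D) := RightDerivedFunctor {
  rdf :> functor (Ho W) (Ho W');
  rdf_unit : nat_trans (Ho_loc W' \of F) (rdf \of Ho_loc W);
  rdf_exists : forall (L : functor (Ho W) (Ho W'))
    (sigma : nat_trans (Ho_loc W' \of F) (L \of Ho_loc W)),
    exists theta : nat_trans rdf L,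
      forall x : C, sigma x =h theta x \c rdf_unit x;
  rdf_unique : forall (L : functor (Ho W) (Ho W')) (theta theta' : nat_trans rdf L),
    (forall x : C, @heq (Ho W') _ _ (theta x \c rdf_unit x)
                                    (theta' x \c rdf_unit x)) ->
    forall x : Ho W, theta x =h theta' x }.

(** ** Chain complexes *)

Record zcategory := ZCategory {
  zcat :> category;
  zeromor : forall x y : zcat, hom x y;
  zeromor_comp : forall (x y z : zcat) (f : hom x y),
    zeromor y z \c f =h zeromor x z;
  comp_zeromor : forall (x y z : zcat) (f : hom y z),
    f \c zeromor x y =h zeromor x z }.

(** [cd X n] is the differential usually denoted [d_(n+1)]. *)
Record complex (C : zcategory) := Complex {
  cx :> int -> C;
  cd : forall n, hom (cx (n + 1)) (cx n);
  cdd : forall n, cd n \c cd (n + 1) =h zeromor _ _ }.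

Arguments cd {C} _ _.

Record chain_map (C : zcategory) (X Y : complex C) := ChainMap {
  cm :> forall n, hom (X n) (Y n);
  cm_comm : forall n, cm n \c cd X n =h cd Y n \c cm (n + 1) }.

Program Definition Ch (C : zcategory) : category :=
  @Category (complex C) (@chain_map C) (fun _ _ f g => forall n, f n =h g n)
    (fun X => @ChainMap C X X (fun n => idm (X n)) _)
    (fun X Y Z g f => @ChainMap C X Z (fun n => g n \c f n) _)
    _ _ _ _ _ _ _.
Next Obligation.
by move=> *; apply: heq_trans (comp1m _) _; apply: heq_sym; apply: compm1.
Qed.
Next Obligation.
move=> C X Y Z g f n; apply: heq_trans (heq_sym (compA _ _ _)) _.
apply: heq_trans (comp_heq (heq_refl _) (cm_comm f n)) _.
apply: heq_trans (compA _ _ _) _.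
apply: heq_trans (comp_heq (cm_comm g n) (heq_refl _)) _.
by apply: heq_sym; apply: compA.
Qed.
Next Obligation. by move=> /= *; apply: heq_refl. Qed.
Next Obligation. by move=> /= *; apply: heq_sym. Qed.
Next Obligation. by move=> /= *; apply: heq_trans; eauto. Qed.
Next Obligation. by move=> /= *; apply: comp_heq. Qed.
Next Obligation. by move=> /= *; apply: comp1m. Qed.
Next Obligation. by move=> /= *; apply: compm1. Qed.
Next Obligation. by move=> /= *; apply: compA. Qed.

Section TermwiseExtension.
Variables (C D : zcategory) (F : functor C D).
Hypothesis F0 : forall x y : C, fmap F (zeromor x y) =h zeromor (F x) (F y).

Program Definition Ch_ob (X : complex C) : complex D :=
  @Complex D (fun n => F (X n)) (fun n => fmap F (cd X n)) _.
Next Obligation.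
move=> X n; apply: heq_trans (heq_sym (fmapM F _ _)) _.
by apply: heq_trans (F0 _ _); apply: fmap_heq; apply: cdd.
Qed.

Program Definition Ch_mor (X Y : complex C) (f : chain_map X Y)
    : chain_map (Ch_ob X) (Ch_ob Y) :=
  @ChainMap D (Ch_ob X) (Ch_ob Y) (fun n => fmap F (f n)) _.
Next Obligation.
move=> X Y f n; apply: heq_trans (heq_sym (fmapM F _ _)) _.
apply: heq_trans _ (fmapM F _ _).
by apply: fmap_heq; apply: cm_comm.
Qed.

Program Definition Ch_functor : functor (Ch C) (Ch D) :=
  @Functor (Ch C) (Ch D) Ch_ob Ch_mor _ _ _.
Next Obligation. by move=> X Y f g fg n; apply: fmap_heq. Qed.
Next Obligation. by move=> X n; apply: fmap1. Qed.
Next Obligation. by move=> X Y Z g f n; apply: fmapM. Qed.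

End TermwiseExtension.

(** * Modules *)

Record submodule (R : pzRingType) (M : lmodType R) := Submodule {
  sm_set :> set M;
  sm0 : sm_set 0;
  smD : forall x y, sm_set x -> sm_set y -> sm_set (x + y);
  smZ : forall a x, sm_set x -> sm_set (a *: x) }.

Section SubmoduleType.
Variables (R : pzRingType) (M : lmodType R) (S : submodule M).

Definition sm_pred : {pred M} := fun x => `[< sm_set S x >].

Lemma sm_pred_closed : GRing.subsemimod_closed sm_pred.
Proof.
split; first split.
- by apply/asboolP; apply: sm0.
- by move=> x y /asboolP Sx /asboolP Sy; apply/asboolP; apply: smD.
- by move=> a x /asboolP Sx; apply/asboolP; apply: smZ.
Qed.

HB.instance Definition _ := GRing.isSubSemiModClosed.Build R M sm_pred
  sm_pred_closed.

Definition sm_type := {x : M | x \in sm_pred}.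
HB.instance Definition _ := SubChoice.on sm_type.
HB.instance Definition _ := [SubChoice_isSubLmodule of sm_type by <:].

Lemma sm_valP a (x y : sm_type) : val (a *: x + y) = a *: val x + val y.
Proof. exact: linearP. Qed.

End SubmoduleType.

Section Modules.
Variable R : pzRingType.
Implicit Types M N P K : lmodType R.

Definition surjective_map (A B : Type) (f : A -> B) := forall y, exists x, f x = y.

Program Definition Mod_cat : category :=
  @Category (lmodType R) (fun M N => {linear M -> N}) (fun _ _ f g => f =1 g)
    (fun M => idfun) (fun _ _ _ g f => g \o f)
    _ _ _ _ _ _ _.
Next Obligation. by []. Qed.
Next Obligation. by move=> M N f g fg x. Qed.
Next Obligation. by move=> M N f g h fg gh x; rewrite fg. Qed.
Next Obligation. by move=> M N P g g' f f' gg' ff' x /=; rewrite ff'. Qed.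
Next Obligation. by []. Qed.
Next Obligation. by []. Qed.
Next Obligation. by []. Qed.

Program Definition Mod : zcategory := @ZCategory Mod_cat (fun M N => \0) _ _.
Next Obligation. by []. Qed.
Next Obligation. by move=> M N P f x /=; apply: raddf0. Qed.

Definition exact_at M N P (f : {linear M -> N}) (g : {linear N -> P}) :=
  forall y, g y = 0 <-> exists x, f x = y.

Definition short_exact M N P (f : {linear M -> N}) (g : {linear N -> P}) :=
  [/\ injective f, exact_at f g & surjective_map g].

Definition acyclic (X : complex Mod) :=
  forall n, exact_at (cd X (n + 1)) (cd X n).

Section Image.
Variables (M N : lmodType R) (f : {linear M -> N}).

Program Definition image_sub : submodule N := @Submodule R N (range f) _ _ _.
Next Obligation. by exists 0 => //; rewrite raddf0. Qed.
Next Obligation.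
by move=> _ _ [x _ <-] [y _ <-]; exists (x + y) => //; rewrite raddfD.
Qed.
Next Obligation. by move=> a _ [x _ <-]; exists (a *: x) => //; rewrite linearZ. Qed.

End Image.

Section SubmoduleMap.
Variables (M N : lmodType R) (S : submodule M) (T : submodule N).
Variables (f : {linear M -> N}) (fST : forall x, sm_set S x -> sm_set T (f x)).

Lemma sm_map_subproof (x : sm_type S) : f (val x) \in sm_pred T.
Proof. by apply/asboolP/fST; have /asboolP := valP x. Qed.

Definition sm_map (x : sm_type S) : sm_type T := exist _ (f (val x)) (sm_map_subproof x).

Lemma sm_map_linear : linear sm_map.
Proof. by move=> a x y; apply: val_inj; rewrite /= linearP. Qed.

HB.instance Definition _ :=
  GRing.isLinear.Build R (sm_type S) (sm_type T) _ sm_map sm_map_linear.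

End SubmoduleMap.


Lemma chain_map_image (X Y : complex Mod) (f : chain_map X Y) x :
  sm_set (image_sub (cd X 0)) x -> sm_set (image_sub (cd Y 0)) (f 0 x).
Proof.
by move=> [y _ <-]; exists (f (0 + 1) y) => //; exact: esym (cm_comm f 0 y).
Qed.

(** The functor [B_0 X = im (X_1 -> X_0)]. *)
Program Definition B0 : functor (Ch Mod) Mod :=
  @Functor (Ch Mod) Mod
    (fun X => sm_type (image_sub (cd X 0)))
    (fun X Y f => sm_map (chain_map_image f)) _ _ _.
Next Obligation. by move=> X Y f g fg x; apply: val_inj; apply: fg. Qed.
Next Obligation. by move=> X x; apply: val_inj. Qed.
Next Obligation. by move=> X Y Z g f x; apply: val_inj. Qed.

Definition projective (P : lmodType R) :=
  forall (M N : lmodType R) (q : {linear M -> N}) (f : {linear P -> N}),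
    surjective_map q -> exists g : {linear P -> M}, q \o g =1 f.

Definition injective_module (E : lmodType R) :=
  forall (M N : lmodType R) (j : {linear M -> N}) (f : {linear M -> E}),
    injective j -> exists g : {linear N -> E}, g \o j =1 f.

Inductive finite_projdim : lmodType R -> Prop :=
| projdim0 (P : lmodType R) : projective P -> finite_projdim P
| projdimS (K P M : lmodType R) (j : {linear K -> P}) (q : {linear P -> M}) :
    short_exact j q -> projective P -> finite_projdim K -> finite_projdim M.

Inductive finite_injdim : lmodType R -> Prop :=
| injdim0 (E : lmodType R) : injective_module E -> finite_injdim E
| injdimS (M E N : lmodType R) (j : {linear M -> E}) (q : {linear E -> N}) :
    short_exact j q -> injective_module E -> finite_injdim N -> finite_injdim M.

Definition left_noetherian :=
  forall J : nat -> submodule R^o,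
    (forall n, sm_set (J n) `<=` sm_set (J n.+1)) ->
    exists m, forall n, (m <= n)%N -> sm_set (J n) = sm_set (J m).

(** [M] is the module of 0-boundaries, equivalently 0-cycles, of [X]. *)
Definition Gorenstein_projective (M : lmodType R) :=
  exists X : complex Mod,
    [/\ forall n, projective (X n),
        acyclic X,
        forall P : lmodType R, projective P ->
          forall n (phi : {linear X (n + 1) -> P}),
            (forall x, phi (cd X (n + 1) x) = 0) ->
            exists psi : {linear X n -> P}, psi \o cd X n =1 phi
      & @isomorphic Mod M (B0 X)].

(** Composites of a monomorphism with projective cokernel followed by an
  epimorphism with kernel of finite projective dimension. *)
Definition Mod_weq : mor_class Mod := fun M N f =>
  exists (E : lmodType R) (j : {linear M -> E}) (q : {linear E -> N}),
    [/\ f =1 q \o j,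
        exists (C : lmodType R) (c : {linear E -> C}),
          short_exact j c /\ projective C
      & exists (K : lmodType R) (i : {linear K -> E}),
          short_exact i q /\ finite_projdim K].

Definition GProj : category := full_sub (C := Mod) Gorenstein_projective.

Definition GProj_incl : functor GProj Mod :=
  @inclusion Mod Gorenstein_projective.

Definition GProj_weq : mor_class GProj :=
  fun x y f => @Mod_weq (sval x) (sval y) f.

(** Functorial trivial fibrations with Gorenstein projective source. *)
Record cofibrant_replacement := CofibrantReplacement {
  cofrep :> functor Mod GProj;
  cofrep_map : nat_trans (GProj_incl \of cofrep) (fid Mod);
  cofrep_fib : forall M : Mod, surjective_map (cofrep_map M);
  cofrep_weq : forall M : Mod, Mod_weq (cofrep_map M) }.

(** [fres M n] is [Y^M_n]; the identification [B_0 Y^M = Z_0 Y^M = M] is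
  recorded as a natural isomorphism [fres_B0], as [B_0 = Z_0] by acyclicity. *)
Record functorial_resolution := FunctorialResolution {
  fres :> functor Mod (Ch Mod);
  fres_acyclic : forall M : Mod, acyclic (fres M);
  fres_B0 : nat_trans (B0 \of fres) (fid Mod);
  fres_B0_iso : forall M : Mod, is_iso (fres_B0 M);
  fres_pos : forall (M : Mod) (n : int), 1 <= n -> projective (fres M n);
  fres_neg : forall (M : Mod) (n : int), n <= 0 -> finite_projdim (fres M n);
  fres_gproj : forall M : Mod,
    Gorenstein_projective M <-> forall n, projective (fres M n) }.

End Modules.

(** Right [R]-modules are left modules over the converse ring [R^c]. *)
Definition Gorenstein_ring (R : pzRingType) :=
  [/\ left_noetherian R, left_noetherian R^c,
      finite_injdim (R^o : lmodType R) & finite_injdim ((R^c)^o : lmodType R^c)].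

(** * Topological groups and smooth representations *)

HB.mixin Record isTopGroup G of Topological G & Group G := {
  mulg_continuous : continuous (fun x : G * G => (x.1 * x.2)%g);
  invg_continuous : continuous (fun x : G => x^-1%g) }.

#[short(type="topGroupType")]
HB.structure Definition TopGroup := {G of Topological G & Group G & isTopGroup G}.

Definition is_subgroup (G : groupType) (A : set G) :=
  [/\ A 1%g, forall x y, A x -> A y -> A (x * y)%g & forall x, A x -> A x^-1%g].

(** The topology on [A] is the subspace topology. *)
Definition profinite (G : topGroupType) (A : set G) :=
  [/\ compact A,
      forall x y, A x -> A y -> x <> y ->
        exists U V : set G, [/\ open U, open V, U x, V y & A `&` (U `&` V) = set0]
    & totally_disconnected A].

(** Openness of [N] is relative to [A]. *)
Definition open_normal_in (G : topGroupType) (A N : set G) :=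
  [/\ is_subgroup N, N `<=` A,
      exists2 U : set G, open U & N = A `&` U
    & forall a x, A a -> N x -> N (a * x * a^-1)%g].

Definition has_index (G : groupType) (A N : set G) (m : nat) :=
  exists r : 'I_m -> G, (forall j, A (r j)) /\
    forall x, A x -> exists! j, N ((r j)^-1 * x)%g.

Definition pro_p (p : nat) (G : topGroupType) (A : set G) :=
  profinite A /\
  forall N, open_normal_in A N -> exists n, has_index A N (p ^ n).

Record open_pro_p_subgroup (p : nat) (G : topGroupType) := OpenProP {
  opp_set :> set G;
  opp_subgroup : is_subgroup opp_set;
  opp_open : open opp_set;
  opp_pro_p : pro_p p opp_set }.

Section Representations.
Variables (k : fieldType) (G : topGroupType).

Record smooth_rep := SmoothRep {
  rep_mod :> lmodType k;
  act : G -> rep_mod -> rep_mod;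
  act_linear : forall g, linear (act g);
  act1 : forall v, act 1%g v = v;
  actM : forall g h v, act (g * h)%g v = act g (act h v);
  act_smooth : forall v, open [set g | act g v = v] }.

Record rep_hom (V W : smooth_rep) := RepHom {
  rep_fun :> V -> W;
  rep_fun_linear : linear rep_fun;
  rep_fun_act : forall g v, rep_fun (act g v) = act g (rep_fun v) }.

HB.instance Definition _ (V W : smooth_rep) (f : rep_hom V W) :=
  GRing.isLinear.Build k V W _ (rep_fun f) (rep_fun_linear f).
HB.instance Definition _ (V : smooth_rep) (g : G) :=
  GRing.isLinear.Build k V V _ (@act V g) (@act_linear V g).

Lemma rep_homZ (V W : smooth_rep) (f : rep_hom V W) a x : f (a *: x) = a *: f x.
Proof. exact: linearZ. Qed.

Lemma actZ (V : smooth_rep) g a (x : V) : act g (a *: x) = a *: act g x.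
Proof. exact: linearZ. Qed.

Lemma rep_homD (V W : smooth_rep) (f : rep_hom V W) x y : f (x + y) = f x + f y.
Proof. exact: raddfD. Qed.

Lemma rep_hom_ext (V W : smooth_rep) (f g : rep_hom V W) :
  rep_fun f = rep_fun g -> f = g.
Proof.
case: f g => [f lf af] [g lg ag] /= fg; subst g.
by rewrite (Prop_irrelevance lf lg) (Prop_irrelevance af ag).
Qed.

Program Definition rep_id (V : smooth_rep) := @RepHom V V id _ _.
Next Obligation. by []. Qed.
Next Obligation. by []. Qed.

Program Definition rep_comp (V W Z : smooth_rep) (g : rep_hom W Z)
  (f : rep_hom V W) := @RepHom V Z (g \o f) _ _.
Next Obligation. by move=> V W Z g f a x y /=; rewrite !linearP. Qed.
Next Obligation. by move=> V W Z g f a x /=; rewrite !rep_fun_act. Qed.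

Program Definition rep_zero (V W : smooth_rep) := @RepHom V W (fun=> 0) _ _.
Next Obligation. by move=> V W a x y; rewrite scaler0 addr0. Qed.
Next Obligation. by move=> V W g x; rewrite raddf0. Qed.

Program Definition rep_opp (V W : smooth_rep) (f : rep_hom V W) :=
  @RepHom V W (fun x => - f x) _ _.
Next Obligation. by move=> V W f a x y; rewrite linearP opprD scalerN. Qed.
Next Obligation. by move=> V W f g x /=; rewrite rep_fun_act raddfN. Qed.

Program Definition rep_add (V W : smooth_rep) (f g : rep_hom V W) :=
  @RepHom V W (fun x => f x + g x) _ _.
Next Obligation.
by move=> V W f g a x y; rewrite !linearP scalerDr addrACA.
Qed.
Next Obligation. by move=> V W f g a x /=; rewrite !rep_fun_act raddfD. Qed.

Program Definition Rep_cat : category :=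
  @Category smooth_rep rep_hom (fun _ _ f g => f =1 g) rep_id rep_comp
    _ _ _ _ _ _ _.
Next Obligation. by []. Qed.
Next Obligation. by move=> M N f g fg x. Qed.
Next Obligation. by move=> M N f g h fg gh x; rewrite fg. Qed.
Next Obligation. by move=> M N P g g' f f' gg' ff' x /=; rewrite ff'. Qed.
Next Obligation. by []. Qed.
Next Obligation. by []. Qed.
Next Obligation. by []. Qed.

Program Definition Rep : zcategory := @ZCategory Rep_cat rep_zero _ _.
Next Obligation. by []. Qed.
Next Obligation. by move=> M N P f x /=; apply: raddf0. Qed.

Program Definition rep_image (V W : smooth_rep) (f : rep_hom V W) : smooth_rep :=
  @SmoothRep (sm_type (image_sub f))
    (fun g => @sm_map k W W (image_sub f) (image_sub f) (@act W g) _) _ _ _ _.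
Next Obligation.
by move=> V W f g _ [x _ <-]; exists (act g x) => //; apply: rep_fun_act.
Qed.
Next Obligation. by move=> V W f g a x y; apply: linearP. Qed.
Next Obligation. by move=> V W f x; apply: val_inj; apply: act1. Qed.
Next Obligation. by move=> V W f g h x; apply: val_inj; apply: actM. Qed.
Next Obligation.
move=> V W f x; rewrite [X in open X](_ : _ = [set g | act g (val x) = val x]).
  exact: act_smooth.
apply/seteqP; split=> g /= e; first by rewrite -[in RHS]e.
by apply: val_inj.
Qed.

Lemma rep_chain_map_image (X Y : complex Rep) (f : chain_map X Y) x :
  sm_set (image_sub (cd X 0)) x -> sm_set (image_sub (cd Y 0)) (f 0 x).
Proof.
by move=> [y _ <-]; exists (f (0 + 1) y) => //; exact: esym (cm_comm f 0 y).
Qed.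

Program Definition rep_B0_mor (X Y : complex Rep) (f : chain_map X Y)
    : rep_hom (rep_image (cd X 0)) (rep_image (cd Y 0)) :=
  @RepHom (rep_image (cd X 0)) (rep_image (cd Y 0))
    (sm_map (rep_chain_map_image f)) _ _.
Next Obligation. by move=> X Y f a x y; apply: linearP. Qed.
Next Obligation.
by move=> X Y f g x; apply: val_inj; apply: rep_fun_act.
Qed.

Program Definition rep_B0 : functor (Ch Rep) Rep :=
  @Functor (Ch Rep) Rep (fun X => rep_image (cd X 0)) rep_B0_mor _ _ _.
Next Obligation. by move=> X Y f g fg x; apply: val_inj; apply: fg. Qed.
Next Obligation. by move=> X x; apply: val_inj. Qed.
Next Obligation. by move=> X Y Z g f x; apply: val_inj. Qed.

End Representations.

Section TranslationTopology.
Variable G : topGroupType.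

Lemma mulg_continuousl (a : G) : continuous (fun x : G => (a * x)%g).
Proof.
move=> x; apply: (@continuous_comp _ _ _ (fun y : G => (a, y))
  (fun z : G * G => (z.1 * z.2)%g)); last exact: mulg_continuous.
by apply: cvg_pair; [exact: cvg_cst|exact: cvg_id].
Qed.

Lemma mulg_continuousr (a : G) : continuous (fun x : G => (x * a)%g).
Proof.
move=> x; apply: (@continuous_comp _ _ _ (fun y : G => (y, a))
  (fun z : G * G => (z.1 * z.2)%g)); last exact: mulg_continuous.
by apply: cvg_pair; [exact: cvg_id|exact: cvg_cst].
Qed.

Lemma open_of_nbhs1 (S U : set G) : open U -> U 1%g -> U `<=` S ->
  (forall x y, S x -> S y -> S (x * y)%g) -> open S.
Proof.
move=> oU U1 US SM; rewrite openE => x Sx; rewrite /interior.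
have oV : open [set y : G | U (x^-1 * y)%g].
  exact: (open_comp (fun y _ => @mulg_continuousl _ y) oU).
apply: (filterS _ (open_nbhs_nbhs (conj oV _))); last by rewrite /= mulVg.
by move=> y /= /US Sy; rewrite -(mulVKg x y); apply: SM.
Qed.

Lemma compact_coset_cover (A K : set G) : open A -> A 1%g -> compact K ->
  exists s : seq G, forall g, K g -> exists2 r, r \in s & A (r^-1 * g)%g.
Proof.
move=> oA A1 cK.
pose pG : ptopologicalType := HB.pack (Topological.sort G) (isPointed.Build _ (1%g : G)).
have : cover_compact (K : set pG) by rewrite -compact_cover.
move=> /(_ G setT (fun r => [set g | A (r^-1 * g)%g])) [].
- move=> r _; exact: (open_comp (fun y _ => @mulg_continuousl _ y) oA).
- by move=> g Kg; exists g => //=; rewrite mulVg.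
by move=> D _ DP; exists (finmap.enum_fset D) => g /DP [r /= rD Ar]; exists r.
Qed.

End TranslationTopology.

(** * Compact induction and the Hecke algebra *)

Section Hecke.
Variables (k : fieldType) (p : nat) (G : topGroupType).
Variable I : open_pro_p_subgroup p G.

Let I1 : opp_set I 1%g. Proof. by case: (opp_subgroup I). Qed.
Let IM x y : opp_set I x -> opp_set I y -> opp_set I (x * y)%g.
Proof. by case: (opp_subgroup I) => _ + _; apply. Qed.
Let IV x : opp_set I x -> opp_set I x^-1%g.
Proof. by case: (opp_subgroup I) => _ _; apply. Qed.

Definition ind_set : set (G -> k^o) := [set f |
  (forall g i, opp_set I i -> f (g * i)%g = f g) /\
  compact (closure [set g | f g != 0])].

Let compact_supp_sub (f f' : G -> k^o) :
  compact (closure [set g | f g != 0]) ->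
  (forall g, f g = 0 -> f' g = 0) -> compact (closure [set g | f' g != 0]).
Proof.
move=> cf ff'; apply: subclosed_compact cf _; first exact: closed_closure.
by apply: closure_subset => g /=; apply: contra_neq; apply: ff'.
Qed.

Program Definition ind_sub : submodule (G -> k^o) := @Submodule k _ ind_set _ _ _.
Next Obligation.
split=> //; rewrite [X in closure X](_ : _ = set0) ?closure0; first exact: compact0.
by apply/seteqP; split=> // g /=; rewrite eqxx.
Qed.
Next Obligation.
move=> f f' [fI cf] [f'I cf']; split=> [g i Ii|].
  by rewrite !fctE fI // f'I.
have cU := compactU cf cf'; rewrite -closureU in cU.
apply: subclosed_compact cU _; first exact: closed_closure.
apply: closure_subset => g /=; case: (eqVneq (f g) 0) => [f0|]; last by left.
case: (eqVneq (f' g) 0) => [f'0|]; last by right.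
by rewrite (_ : (f + f') g = f g + f' g) // f0 f'0 addr0 eqxx.
Qed.
Next Obligation.
move=> a f [fI cf]; split=> [g i Ii|]; first by rewrite !fctE fI.
apply: compact_supp_sub cf _ => g f0.
by rewrite (_ : (a *: f) g = a * f g) // f0 mulr0.
Qed.

Definition ind_type : lmodType k := sm_type ind_sub.

Implicit Types f : ind_type.

Lemma indP f : ind_set (val f).
Proof. by have /asboolP := valP f. Qed.

Lemma ind_translate (g : G) f : ind_set (fun x => val f (g^-1 * x)%g).
Proof.
have [fI cf] := indP f; split=> [x i Ii|]; first by rewrite mulgA fI.
have cK : compact ((fun x => (g * x)%g) @` closure [set x | val f x != 0]).
  apply: continuous_compact cf; apply: continuous_subspaceT.
  exact: mulg_continuousl.
apply: subclosed_compact cK _; first exact: closed_closure.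
rewrite -[X in _ `<=` X](_ : [set x | closure [set y | val f y != 0] (g^-1 * x)%g]
  = _); last first.
  apply/seteqP; split=> [x /= cx|_ [x cx <-] /=]; last by rewrite mulKg.
  by exists (g^-1 * x)%g => //; rewrite mulVKg.
rewrite (_ : mkset _ = (fun x => (g^-1 * x)%g) @^-1` closure [set y | val f y != 0]) //.
rewrite closureE => x; apply; split.
  by apply: closed_comp; [move=> y _; exact: mulg_continuousl|exact: closed_closure].
by move=> y /= fy; apply: subset_closure.
Qed.

Definition ind_act (g : G) f : ind_type :=
  exist _ (fun x => val f (g^-1 * x)%g) (asboolT (ind_translate g f)).

Lemma ind_actE g f x : val (ind_act g f) x = val f (g^-1 * x)%g.
Proof. by []. Qed.

Lemma ind_supp f :
  exists s : seq G, forall g, val f g != 0 -> exists2 r, r \in s & opp_set I (r^-1 * g)%g.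
Proof.
have [_ cf] := indP f.
have [s sP] := compact_coset_cover (opp_open I) I1 cf.
by exists s => g fg; apply: sP; apply: subset_closure.
Qed.

Lemma ind_valP a f f' g : val (a *: f + f') g = a * val f g + val f' g.
Proof. by rewrite sm_valP. Qed.

Lemma ind_act_linear g : linear (ind_act g).
Proof. 
move=> a f f'; apply: val_inj; apply/funext => x.
by rewrite ind_valP !ind_actE ind_valP.
Qed.

Lemma ind_act1 f : ind_act 1%g f = f.
Proof. by apply: val_inj; apply/funext => x; rewrite ind_actE invg1 mul1g. Qed.

Lemma ind_actM g h f : ind_act (g * h)%g f = ind_act g (ind_act h f).
Proof. by apply: val_inj; apply/funext => x; rewrite !ind_actE invgM mulgA. Qed.

Lemma ind_act_smooth f : open [set g | ind_act g f = f].
Proof.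
have [fI _] := indP f; have [s sP] := ind_supp f.
pose U := [set g : G | forall r, r \in s -> opp_set I (r^-1 * (g * r))%g].
have oU : open U.
  rewrite {}/U; elim: s {sP} => [|r s IHs].
    by rewrite [X in open X](_ : _ = setT); [exact: openT|apply/seteqP].
  rewrite [X in open X](_ : _ = [set g | opp_set I (r^-1 * (g * r))%g] `&`
    [set g | forall r, r \in s -> opp_set I (r^-1 * (g * r))%g]).
    apply: openI => //.
    have o1 := open_comp (fun y _ => @mulg_continuousl _ r^-1%g y) (opp_open I).
    exact: (open_comp (fun y _ => @mulg_continuousr _ r y) o1).
  apply/seteqP; split=> g /=.
    by move=> gP; split=> [|t ts]; apply: gP; rewrite inE ?eqxx // ts orbT.
  by move=> [gr gs] t; rewrite inE => /orP[/eqP->|/gs].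
have U1 : U 1%g by move=> r _; rewrite mul1g mulVg.
apply: (open_of_nbhs1 oU U1); last first.
  by move=> x y /= ex ey; rewrite ind_actM ey.
have conjI u x : U u -> val f x != 0 -> opp_set I (x^-1 * (u * x))%g.
  move=> Uu /sP [r rs Ir].
  have -> : (x^-1 * (u * x) =
      (r^-1 * x)^-1 * ((r^-1 * (u * r)) * (r^-1 * x)))%g.
    by rewrite invgM invgK !mulgA mulgK !(mulgVK, mulgK).
  by apply: IM; [exact: IV|apply: IM => //; exact: Uu].
move=> u Uu /=; apply: val_inj; apply/funext => g; rewrite ind_actE.
have [fg0|fgN0] := eqVneq (val f g) 0.
  rewrite fg0; apply: contraTeq isT => fN0.
  have /fI := conjI _ _ Uu fN0.
  by move=> /(_ (u^-1 * g)%g); rewrite !mulVKg fg0 => e; rewrite -e eqxx in fN0.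
have /IV /fI := conjI _ _ Uu fgN0; move=> /(_ g) <-.
by congr (val f _); rewrite !invgM invgK !mulgA mulgV mul1g.
Qed.


Definition compact_ind : smooth_rep k G :=
  @SmoothRep k G ind_type ind_act ind_act_linear ind_act1 ind_actM
    ind_act_smooth.

Definition ind_one_fun (g : G) : k^o := (`[< opp_set I g >])%:R.

Lemma ind_one_subproof : ind_set ind_one_fun.
Proof.
rewrite /ind_one_fun; split=> [g i Ii|].
  congr (nat_of_bool _)%:R; apply: asbool_equiv_eq; split=> [Igi|Ig].
    by rewrite -(mulgK i g); apply: IM => //; exact: IV.
  exact: IM.
have [[cI _ _] _] := opp_pro_p I.
apply: subclosed_compact cI _; first exact: closed_closure.
move=> x cx; have oxI : open [set y : G | opp_set I (x^-1 * y)%g].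
  exact: (open_comp (fun y _ => @mulg_continuousl _ x^-1%g y) (opp_open I)).
have Ixx : opp_set I (x^-1 * x)%g by rewrite mulVg.
have [y [/=]] := cx _ (open_nbhs_nbhs (conj oxI Ixx)).
case: asboolP => [Iy _ Ixy|_]; last by rewrite eqxx.
by rewrite -(invgK x) -(mulgK y x^-1%g) invgM invgK; apply: IM => //; exact: IV.
Qed.

(** The characteristic function of [I]. *)
Definition ind_one : ind_type := exist _ ind_one_fun (asboolT ind_one_subproof).

Program Definition inv_sub (V : smooth_rep k G) : submodule V :=
  @Submodule k V [set v | forall i, opp_set I i -> act i v = v] _ _ _.
Next Obligation. by move=> V i _; rewrite raddf0. Qed.
Next Obligation. by move=> V x y Ix Iy i Ii; rewrite raddfD /= Ix // Iy. Qed.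
Next Obligation. by move=> V a x Ix i Ii; rewrite linearZ /= Ix. Qed.

Definition inv_type (V : smooth_rep k G) := sm_type (inv_sub V).

Lemma invP (V : smooth_rep k G) (v : inv_type V) i :
  opp_set I i -> act i (val v) = val v.
Proof. by have /asboolP := valP v; apply. Qed.

(** A system of representatives of [G/I]. *)
Definition coset_rep (g : G) : G := xget 1%g [set h | opp_set I (g^-1 * h)%g].

Lemma coset_repP g : opp_set I (g^-1 * coset_rep g)%g.
Proof.
rewrite /coset_rep; case: xgetP => [x -> //|/(_ g) /=].
by rewrite mulVg => /(_ I1).
Qed.

Lemma coset_rep_eq g h : opp_set I (g^-1 * h)%g -> coset_rep g = coset_rep h.
Proof.
move=> Igh; congr (xget _ _); apply/seteqP; split=> x /= Ix.
  rewrite -(mulKg (g^-1 * h)%g (h^-1 * x)%g); apply: IM; first exact: IV.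
  by rewrite mulgA mulgK.
by rewrite -(mulgK h g^-1%g) -mulgA; apply: IM.
Qed.

Lemma coset_repK g : coset_rep (coset_rep g) = coset_rep g.
Proof. exact/esym/coset_rep_eq/coset_repP. Qed.

Lemma ind_coset_rep (f : ind_type) g : val f (coset_rep g) = val f g.
Proof.
have [fI _] := indP f; rewrite -(fI g (g^-1 * coset_rep g)%g) ?mulVKg //.
exact: coset_repP.
Qed.

Lemma act_coset_rep (V : smooth_rep k G) (v : inv_type V) g :
  act (coset_rep g) (val v) = act g (val v).
Proof. by rewrite -{1}(mulVKg g (coset_rep g)) actM invP //; exact: coset_repP. Qed.

(** The [G]-morphism [X -> V] sending [ind_one] to an [I]-invariant [v]. *)
Definition frob_fun (V : smooth_rep k G) (v : inv_type V) (f : ind_type) : V :=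
  \sum_(r \in range coset_rep) (val f r *: act r (val v)).

Definition supp_seq (f : ind_type) (s : seq G) :=
  [/\ uniq s, {in s, forall r, coset_rep r = r}
    & forall g, val f g != 0 -> coset_rep g \in s].

Lemma supp_seq_exists (f : ind_type) : exists s, supp_seq f s.
Proof.
have [s sP] := ind_supp f.
exists (undup (map coset_rep s)); split; first exact: undup_uniq.
  by move=> r; rewrite mem_undup => /mapP [x _ ->]; rewrite coset_repK.
move=> g /sP [r rs /coset_rep_eq <-]; rewrite mem_undup.
exact: map_f.
Qed.

Lemma supp_seq_exists2 (f f' : ind_type) :
  exists s, supp_seq f s /\ supp_seq f' s.
Proof.
have [s [_ s1 s2]] := supp_seq_exists f.
have [s' [_ s'1 s'2]] := supp_seq_exists f'.
exists (undup (s ++ s')); split; split; rewrite ?undup_uniq //.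
- by move=> r; rewrite mem_undup mem_cat => /orP[/s1|/s'1].
- by move=> g /s2; rewrite mem_undup mem_cat => ->.
- by move=> r; rewrite mem_undup mem_cat => /orP[/s1|/s'1].
- by move=> g /s'2; rewrite mem_undup mem_cat orbC => ->.
Qed.

Lemma frob_funE V (v : inv_type V) f s : supp_seq f s ->
  frob_fun v f = \sum_(r <- s) (val f r *: act r (val v)).
Proof.
move=> [us sr sf]; rewrite /frob_fun (fsbigE s) //; last first.
- move=> r [g _ <-]; apply: contraNeq => /eqP.
  have [-> |/sf] := eqVneq (val f (coset_rep g)) 0; first by rewrite scale0r.
  by rewrite coset_repK.
- by move=> r /= /sr <-; exists r.
rewrite big_mkcond [RHS]big_seq; rewrite big_seq; apply: eq_bigr => r rs.
by rewrite ifT // inE; exists r => //; exact: sr.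
Qed.

Lemma frob_fun_linear V (v : inv_type V) : linear (frob_fun v).
Proof.
move=> a f f'; have [s [fs f's]] := supp_seq_exists2 f f'.
have ffs : supp_seq (a *: f + f') s.
  have [us sr sf] := fs; have [_ _ sf'] := f's; split=> // g.
  have [f0|/sf //] := eqVneq (val f g) 0.
  have [f'0|/sf' //] := eqVneq (val f' g) 0.
  by rewrite ind_valP f0 f'0 mulr0 addr0 eqxx.
rewrite !(frob_funE _ fs, frob_funE _ f's, frob_funE _ ffs).
rewrite scaler_sumr -big_split /=; apply: eq_bigr => r _.
by rewrite scalerA -scalerDl.
Qed.

Lemma frob_fun_act V (v : inv_type V) g f :
  frob_fun v (ind_act g f) = act g (frob_fun v f).
Proof.
have [s fs] := supp_seq_exists f; have [us sr sf] := fs.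
have gfs : supp_seq (ind_act g f) (map (fun r => coset_rep (g * r)%g) s).
  split.
  - rewrite map_inj_in_uniq // => r r' rs r's /esym e.
    rewrite -(sr _ rs) -(sr _ r's); apply: coset_rep_eq.
    have := coset_repP (g * r)%g; have := coset_repP (g * r')%g.
    rewrite e => /IV b a; have := IM a b.
    rewrite !invgM !invgK !mulgA mulgK mulgVK; exact.
  - by move=> _ /mapP [r _ ->]; rewrite coset_repK.
  - move=> x; rewrite ind_actE => /sf fx.
    apply/mapP; exists (coset_rep (g^-1 * x)%g) => //; apply: coset_rep_eq.
    have := coset_repP (g^-1 * x)%g.
    by rewrite invgM invgK mulgA.
rewrite (frob_funE _ fs) (frob_funE _ gfs) big_map raddf_sum /=.
apply: eq_bigr => r _; rewrite linearZ /=; congr (_ *: _).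
  transitivity (val (ind_act g f) (coset_rep (g * r)%g)); first by [].
  by rewrite ind_coset_rep ind_actE mulKg.
by rewrite act_coset_rep actM.
Qed.

Definition frob V (v : inv_type V) : rep_hom compact_ind V :=
  @RepHom k G compact_ind V (frob_fun v) (frob_fun_linear v) (frob_fun_act v).

Lemma frob_one V (v : inv_type V) : frob v ind_one = val v.
Proof.
have fs : supp_seq ind_one [:: coset_rep 1%g].
  split=> //; first by move=> r; rewrite inE => /eqP ->; exact: coset_repK.
  move=> g /=; rewrite /ind_one_fun; case: asboolP => [Ig _|_]; last by rewrite eqxx.
  by rewrite inE; apply/eqP/esym/coset_rep_eq; rewrite invg1 mul1g.
rewrite /= (frob_funE _ fs) big_seq1 ind_coset_rep act_coset_rep act1 /= /ind_one_fun.
by rewrite asboolT // scale1r.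
Qed.

Lemma ind_generated (f : ind_type) s : supp_seq f s ->
  f = \sum_(r <- s) (val f r *: ind_act r ind_one).
Proof.
move=> [us sr sf]; apply: val_inj; rewrite raddf_sum /=; apply/funext => g.
rewrite fct_sumE.
have E r : (val f r *: val (ind_act r ind_one)) g
    = val f r * (`[< opp_set I (r^-1 * g)%g >])%:R by [].
have inI r : r \in s -> opp_set I (r^-1 * g)%g -> r = coset_rep g.
  by move=> rs; move=> /coset_rep_eq <-; rewrite sr.
have repI : opp_set I ((coset_rep g)^-1 * g)%g.
  by have /IV := coset_repP g; rewrite invgM invgK.
have [f0|/sf gs] := eqVneq (val f g) 0.
  rewrite f0 big_seq big1 // => r rs; rewrite E.
  case: asboolP => [/(inI _ rs) ->|_]; last by rewrite mulr0.
  by rewrite ind_coset_rep f0 mul0r.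
rewrite (bigD1_seq (coset_rep g)) //= E asboolT // ind_coset_rep mulr1.
rewrite big_seq_cond big1 ?addr0 // => r /andP [rs rg]; rewrite E.
case: asboolP => [/(inI _ rs) e|_]; last by rewrite mulr0.
by rewrite e eqxx in rg.
Qed.

Lemma ind_hom_ext V (phi psi : rep_hom compact_ind V) :
  phi ind_one = psi ind_one -> phi = psi.
Proof.
move=> e; apply: rep_hom_ext; apply/funext => f.
have [s /ind_generated ->] := supp_seq_exists f.
have E (chi : rep_hom compact_ind V) :
    chi (\sum_(r <- s) (val f r *: ind_act r ind_one))
    = \sum_(r <- s) (val f r *: act r (chi ind_one)).
  rewrite raddf_sum; apply: eq_bigr => r _.
  apply: etrans (rep_homZ chi _ _) _; congr (_ *: _).
  exact: (rep_fun_act chi r ind_one).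
by rewrite !E e.
Qed.

End Hecke.

Section HeckeModules.
Variables (k : fieldType) (p : nat) (G : topGroupType).
Variable I : open_pro_p_subgroup p G.

Definition hecke : Type := rep_hom (compact_ind k I) (compact_ind k I).

HB.instance Definition _ := gen_eqMixin hecke.
HB.instance Definition _ := gen_choiceMixin hecke.

Local Ltac hecke_ext := apply: rep_hom_ext; apply/funext => ? /=.

Lemma hecke_addA : associative (@rep_add k G _ _ : hecke -> hecke -> hecke).
Proof. by move=> a b c; hecke_ext; rewrite addrA. Qed.
Lemma hecke_addC : commutative (@rep_add k G _ _ : hecke -> hecke -> hecke).
Proof. by move=> a b; hecke_ext; rewrite addrC. Qed.
Lemma hecke_add0 :
  left_id (rep_zero _ _ : hecke) (@rep_add k G _ _ : hecke -> hecke -> hecke).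
Proof. by move=> a; hecke_ext; rewrite add0r. Qed.
Lemma hecke_addN : left_inverse (rep_zero _ _ : hecke)
  (@rep_opp k G _ _ : hecke -> hecke) (@rep_add k G _ _ : hecke -> hecke -> hecke).
Proof. by move=> a; hecke_ext; rewrite addNr. Qed.

HB.instance Definition _ := GRing.isZmodule.Build hecke
  hecke_addA hecke_addC hecke_add0 hecke_addN.

(** The product is opposite to the composition of endomorphisms. *)
Definition hecke_mul (a b : hecke) : hecke := rep_comp b a.
Definition hecke_one : hecke := rep_id _.

Lemma hecke_mulA : associative hecke_mul.
Proof. by move=> a b c; hecke_ext. Qed.
Lemma hecke_mul1l : left_id hecke_one hecke_mul.
Proof. by move=> a; hecke_ext. Qed.
Lemma hecke_mul1r : right_id hecke_one hecke_mul.
Proof. by move=> a; hecke_ext. Qed.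
Lemma hecke_mulDl : left_distributive hecke_mul +%R.
Proof.
move=> a b c; apply: rep_hom_ext; apply/funext => x.
exact: (rep_homD c (a x) (b x)).
Qed.
Lemma hecke_mulDr : right_distributive hecke_mul +%R.
Proof. by move=> a b c; hecke_ext. Qed.

HB.instance Definition _ := GRing.Zmodule_isPzRing.Build hecke
  hecke_mulA hecke_mul1l hecke_mul1r hecke_mulDl hecke_mulDr.

Definition hecke_ring : pzRingType := hecke.

(** ** The functor of [I]-invariants *)

Section Invariants.
Variable V : smooth_rep k G.

Definition U_type := inv_type I V.
HB.instance Definition _ := GRing.Zmodule.on U_type.

Lemma U_scale_subproof (h : hecke) (v : U_type) :
  frob v (h (ind_one k I)) \in sm_pred (inv_sub I V).
Proof.
apply/asboolP => i Ii; rewrite -rep_fun_act -rep_fun_act; congr (frob v (h _)).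
apply: val_inj; apply/funext => g; rewrite ind_actE /= /ind_one_fun.
congr (nat_of_bool _)%:R; have [_ IM IV] := opp_subgroup I.
apply: asbool_equiv_eq; split=> [Iig|Ig]; last by apply: IM => //; exact: IV.
by rewrite -(mulVKg i g); apply: IM.
Qed.

(** Under Frobenius reciprocity [V^I = Hom_G (X, V)], [h] acts by
  precomposition. *)
Definition U_scale (h : hecke) (v : U_type) : U_type :=
  exist _ (frob v (h (ind_one k I))) (U_scale_subproof h v).

Lemma U_scaleA a b v : U_scale a (U_scale b v) = U_scale (a * b) v.
Proof.
apply: val_inj; suff e : frob (U_scale b v) = rep_comp (frob v) b.
  exact: (congr1 (fun phi : rep_hom _ _ => phi (a (ind_one k I))) e).
by apply: ind_hom_ext; rewrite frob_one.
Qed.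

Lemma U_scale1 : left_id 1 U_scale.
Proof. by move=> v; apply: val_inj; apply: frob_one. Qed.

Lemma U_scaleDr : right_distributive U_scale +%R.
Proof.
move=> h v w; apply: val_inj.
suff e : frob (v + w : U_type) = rep_add (frob v) (frob w).
  exact: (congr1 (fun phi : rep_hom _ _ => phi (h (ind_one k I))) e).
apply: ind_hom_ext; rewrite frob_one /=.
by have /= -> := frob_one v; have /= -> := frob_one w.
Qed.

Lemma U_scaleDl v : {morph U_scale^~ v : a b / a + b}.
Proof. move=> a b; apply: val_inj.
exact: (rep_homD (frob v) (a (ind_one k I)) (b (ind_one k I))).
 Qed.

HB.instance Definition _ := GRing.Zmodule_isLmodule.Build hecke_ring U_type
  U_scaleA U_scale1 U_scaleDr U_scaleDl.

End Invariants.

Section InvariantsMap.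
Variables (V W : smooth_rep k G) (f : rep_hom V W).

Lemma U_map_subproof (v : U_type V) : f (val v) \in sm_pred (inv_sub I W).
Proof. by apply/asboolP => i Ii; rewrite -rep_fun_act invP. Qed.

Definition U_map (v : U_type V) : U_type W := exist _ (f (val v)) (U_map_subproof v).

Lemma U_map_linear : linear U_map.
Proof.
move=> h v w; apply: val_inj; rewrite /= raddfD /=; congr (_ + _).
suff e : rep_comp f (frob v) = frob (U_map v).
  exact: (congr1 (fun phi : rep_hom _ _ => phi (h (ind_one k I))) e).
apply: ind_hom_ext; have /= -> := frob_one (U_map v).
by have /= -> := frob_one v.
Qed.

HB.instance Definition _ :=
  GRing.isLinear.Build hecke_ring (U_type V) (U_type W) _ U_map U_map_linear.

End InvariantsMap.

Program Definition U_functor : functor (Rep k G) (Mod hecke_ring) :=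
  @Functor (Rep k G) (Mod hecke_ring) (fun V => U_type V) (fun V W f => U_map f)
    _ _ _.
Next Obligation. by move=> V W f g fg v; apply: val_inj; apply: fg. Qed.
Next Obligation. by move=> V v; apply: val_inj. Qed.
Next Obligation. by move=> V W Z g f v; apply: val_inj. Qed.

(** ** The tensor product with [X]

  A word [[:: (x1, m1); ...; (xn, mn)]] stands for the sum of the [xi (x) mi];
  words are taken modulo the smallest congruence making concatenation
  commutative and the tensor sign biadditive and [H]-balanced, where the right
  action of [H] on [X] is evaluation. *)

Section Tensor.
Variable M : lmodType hecke_ring.

Local Notation X := (compact_ind k I).
Local Notation word := (seq (X * M)).

Inductive tensor_rel : word -> word -> Prop :=
| TRrefl s : tensor_rel s s
| TRsym s t : tensor_rel s t -> tensor_rel t s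
| TRtrans s t u : tensor_rel s t -> tensor_rel t u -> tensor_rel s u
| TRcat s s' t t' :
    tensor_rel s s' -> tensor_rel t t' -> tensor_rel (s ++ t) (s' ++ t')
| TRcomm s t : tensor_rel (s ++ t) (t ++ s)
| TR0 m : tensor_rel [:: (0, m)] [::]
| TRDl x y m : tensor_rel [:: (x + y, m)] [:: (x, m); (y, m)]
| TRDr x m n : tensor_rel [:: (x, m + n)] [:: (x, m); (x, n)]
| TRbal x (h : hecke) m : tensor_rel [:: (h x, m)] [:: (x, h *: m)].

Definition tensor_eq : rel word := fun s t => `[< tensor_rel s t >].

Lemma tensor_eq_equiv : equiv_class_of tensor_eq.
Proof.
split.
- by move=> s; apply/asboolP; apply: TRrefl.
- by move=> s t; apply/asboolP/asboolP; apply: TRsym.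
- move=> t s u /asboolP st /asboolP tu; apply/asboolP; exact: TRtrans tu.
Qed.

Canonical tensor_equiv := EquivRelPack tensor_eq_equiv.

Definition tensor := {eq_quot tensor_eq}.
HB.instance Definition _ := Choice.on tensor.

Definition tpi (s : word) : tensor := \pi s.

Lemma tpiP s t : tensor_rel s t -> tpi s = tpi t.
Proof. by move=> st; apply/eqmodP/asboolP. Qed.

Lemma tpi_rel s t : tpi s = tpi t -> tensor_rel s t.
Proof. by move=> /eqmodP/asboolP. Qed.

Lemma tensorW (P : tensor -> Prop) : (forall s, P (tpi s)) -> forall x, P x.
Proof. by move=> PP x; rewrite -[x]reprK; apply: PP. Qed.

(** Functions on tensors induced by functions on words. *)
Definition tlift (f : word -> word) (x : tensor) : tensor := tpi (f (repr x)).

Lemma tliftE f s :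
  (forall s t, tensor_rel s t -> tensor_rel (f s) (f t)) ->
  tlift f (tpi s) = tpi (f s).
Proof. by move=> fP; apply/tpiP/fP/tpi_rel; rewrite /tpi reprK. Qed.

Definition tadd (x y : tensor) : tensor := tpi (repr x ++ repr y).

Lemma taddE s t : tadd (tpi s) (tpi t) = tpi (s ++ t).
Proof. by apply/tpiP/TRcat; apply/tpi_rel; rewrite /tpi reprK. Qed.

End Tensor.

Lemma tmap_rel (M N : lmodType hecke_ring)
    (f : compact_ind k I -> compact_ind k I) (g : M -> N) :
  (forall x y, f (x + y) = f x + f y) -> (forall m n, g (m + n) = g m + g n) ->
  (forall (h : hecke) x, f (h x) = h (f x)) ->
  (forall (h : hecke) m, g (h *: m) = h *: g m) ->
  forall s t, tensor_rel s t ->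
  tensor_rel [seq (f u.1, g u.2) | u <- s] [seq (f u.1, g u.2) | u <- t].
Proof.
move=> fD gD fh gh s t; elim=> {s t} /=.
- by move=> s; apply: TRrefl.
- by move=> s t _; apply: TRsym.
- by move=> s t u _ + _; apply: TRtrans.
- by move=> s s' t t' _ ss' _ tt'; rewrite !map_cat; apply: TRcat.
- by move=> s t; rewrite !map_cat; apply: TRcomm.
- move=> m; have -> : f 0 = 0 by apply: (addIr (f 0)); rewrite -fD !add0r.
  exact: TR0.
- by move=> x y m; rewrite fD; apply: TRDl.
- by move=> x m n; rewrite gD; apply: TRDr.
- by move=> x h m; rewrite fh gh; apply: TRbal.
Qed.

Section TensorModule.
Variable M : lmodType hecke_ring.
Local Notation X := (compact_ind k I).
Local Notation T := (tensor M).

Definition tmap (f : X -> X) : T -> T := tlift (map (fun u => (f u.1, u.2))).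

Lemma tmapE f s :
  (forall x y, f (x + y) = f x + f y) ->
  (forall (h : hecke) x, f (h x) = h (f x)) ->
  tmap f (tpi s) = tpi [seq (f u.1, u.2) | u <- s].
Proof. by move=> fD fh; apply: tliftE; apply: (@tmap_rel M M f id). Qed.

Definition tscale (a : k) : T -> T := tmap ( *:%R a).
Definition topp : T -> T := tmap -%R.
Definition tact (g : G) : T -> T := tmap (@act k G X g).

Lemma tscaleE a s : tscale a (tpi s) = tpi [seq (a *: u.1, u.2) | u <- s].
Proof.
by apply: tmapE => [x y|h x]; [rewrite scalerDr|rewrite rep_homZ].
Qed.
Lemma toppE s : topp (tpi s) = tpi [seq (- u.1, u.2) | u <- s].
Proof. by apply: tmapE => [x y|h x]; [rewrite opprD|rewrite raddfN]. Qed.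
Lemma tactE g s : tact g (tpi s) = tpi [seq (act g u.1, u.2) | u <- s].
Proof. by apply: tmapE => [x y|h x]; [rewrite raddfD|rewrite rep_fun_act]. Qed.

Lemma taddA : associative (@tadd M).
Proof.
elim/tensorW => s; elim/tensorW => t; elim/tensorW => u.
by rewrite !taddE catA.
Qed.
Lemma taddC : commutative (@tadd M).
Proof.
elim/tensorW => s; elim/tensorW => t; rewrite !taddE; exact/tpiP/TRcomm.
Qed.
Lemma tadd0 : left_id (tpi [::]) (@tadd M).
Proof. by elim/tensorW => s; rewrite taddE. Qed.
Lemma taddN : left_inverse (tpi [::]) topp (@tadd M).
Proof.
elim/tensorW => s; rewrite toppE taddE; apply: tpiP.
elim: s => [|[x m] s IHs]; first exact: TRrefl.
rewrite -cat1s -[map _ _ ++ _ :: s]/(([:: (- x, m)] ++ _) ++ ([:: (x, m)] ++ s)).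
apply: (TRtrans (t := [:: (- x, m); (x, m)] ++
    ([seq (- u.1, u.2) | u <- s] ++ s))); last first.
  rewrite -[X in tensor_rel _ X]cat0s; apply: TRcat => //.
  apply: TRtrans (TR0 m); rewrite -(addNr x); apply: TRsym; exact: TRDl.
rewrite -catA -[[:: (- x, m); (x, m)]]/([:: (- x, m)] ++ [:: (x, m)]) -catA.
apply: TRcat; first exact: TRrefl.
by rewrite !catA; apply: TRcat; [exact: TRcomm|exact: TRrefl].
Qed.

HB.instance Definition _ := GRing.isZmodule.Build T taddA taddC tadd0 taddN.

Lemma tpiD s t : tpi s + tpi t = tpi (s ++ t) :> T.
Proof. exact: taddE. Qed.

Lemma tscaleA a b x : tscale a (tscale b x) = tscale (a * b) x.
Proof.
elim/tensorW: x => s; rewrite !tscaleE -map_comp; congr tpi.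
by apply: eq_map => u /=; rewrite scalerA.
Qed.
Lemma tscale1 : left_id 1 tscale.
Proof.
elim/tensorW => s; rewrite tscaleE; congr tpi; rewrite -[RHS]map_id.
by apply: eq_map => -[x m] /=; rewrite scale1r.
Qed.
Lemma tscaleDr : right_distributive tscale +%R.
Proof.
move=> a; elim/tensorW => s; elim/tensorW => t.
by rewrite !(tpiD, tscaleE) map_cat.
Qed.
Lemma tscaleDl x : {morph tscale^~ x : a b / a + b}.
Proof.
elim/tensorW: x => s a b; rewrite !tscaleE tpiD; apply: tpiP.
elim: s => [|[x m] s IHs]; first exact: TRrefl.
rewrite /= -cat1s scalerDl.
apply: (TRtrans (TRcat (TRDl _ _ _) IHs)).
rewrite -[_ ++ _ ++ _]/([:: _] ++ ([:: _] ++ (_ ++ _))) -[X in tensor_rel _ X]cat1s.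
apply: TRcat; first exact: TRrefl.
rewrite !catA -[X in tensor_rel _ (_ ++ X)]cat1s catA.
by apply: TRcat; [exact: TRcomm|exact: TRrefl].
Qed.

HB.instance Definition _ := GRing.Zmodule_isLmodule.Build k T
  tscaleA tscale1 tscaleDr tscaleDl.

Lemma tact_linear g : linear (tact g).
Proof.
move=> a; elim/tensorW => s; elim/tensorW => t.
rewrite -![_ *: _]/(tscale _ _) tscaleE tpiD !tactE tscaleE tpiD map_cat.
congr (tpi (_ ++ _)).
rewrite -!map_comp; apply: eq_map => u /=; congr (_, _).
exact: (@actZ _ _ X).
Qed.
Lemma tact1 x : tact 1%g x = x.
Proof.
elim/tensorW: x => s; rewrite tactE; congr tpi; rewrite -[RHS]map_id.
by apply: eq_map => -[x m] /=; congr (_, _); exact: (act1 (s := X)).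
Qed.
Lemma tactM g h x : tact (g * h)%g x = tact g (tact h x).
Proof.
elim/tensorW: x => s; rewrite !tactE -map_comp; congr tpi.
by apply: eq_map => u /=; congr (_, _); exact: (actM (s := X)).
Qed.
Lemma tact_smooth x : open [set g | tact g x = x].
Proof.
elim/tensorW: x => s.
pose S := [set g : G | forall u, u \in s -> act g u.1 = u.1].
apply: (@open_of_nbhs1 G _ S).
- rewrite {}/S; elim: s => [|u s IHs].
    by rewrite [X in open X](_ : _ = setT); [exact: openT|apply/seteqP].
  rewrite [X in open X](_ : _ = [set g | act g u.1 = u.1] `&`
    [set g | forall u, u \in s -> act g u.1 = u.1]).
    by apply: openI => //; exact: act_smooth.
  apply/seteqP; split=> g /=.
    by move=> gP; split=> [|t ts]; apply: gP; rewrite inE ?eqxx // ts orbT.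
  by move=> [gr gs] t; rewrite inE => /orP[/eqP->|/gs].
- by move=> u _; exact: (act1 (s := X)).
- move=> g gP /=; rewrite tactE; congr tpi; rewrite -[RHS]map_id.
  by apply/eq_in_map => -[x m] /gP /= ->.
- by move=> g h /= eg eh; rewrite tactM eh.
Qed.

Definition F_ob : smooth_rep k G :=
  @SmoothRep k G T tact tact_linear tact1 tactM tact_smooth.

End TensorModule.

Section TensorMap.
Variables (M N : lmodType hecke_ring) (f : {linear M -> N}).

Definition F_fun (x : F_ob M) : F_ob N :=
  tpi [seq (u.1, f u.2) | u <- repr (x : tensor M)].

Lemma F_funE s : F_fun (tpi s) = tpi [seq (u.1, f u.2) | u <- s].
Proof.
apply: tpiP; apply: (@tmap_rel M N id f) => //; try by move=> *; rewrite linearE.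
by apply: tpi_rel; rewrite /tpi reprK.
Qed.

Lemma F_fun_linear : linear F_fun.
Proof.
move=> a; elim/tensorW => s; elim/tensorW => t.
rewrite -![_ *: _]/(tscale _ _) tscaleE tpiD !F_funE tscaleE tpiD map_cat.
by congr (tpi (_ ++ _)); rewrite -!map_comp.
Qed.
Lemma F_fun_act g x : F_fun (act g x) = act g (F_fun x).
Proof.
elim/tensorW: x => s; rewrite F_funE -![act _ _]/(tact _ _) !tactE F_funE.
by rewrite -!map_comp.
Qed.

Definition F_mor : rep_hom (F_ob M) (F_ob N) := RepHom F_fun_linear F_fun_act.

End TensorMap.

Program Definition F_functor : functor (Mod hecke_ring) (Rep k G) :=
  @Functor (Mod hecke_ring) (Rep k G) F_ob F_mor _ _ _.
Next Obligation.
move=> M N f g fg; elim/tensorW => s; rewrite /= !F_funE; congr tpi.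
by apply: eq_map => u; rewrite fg.
Qed.
Next Obligation.
move=> M; elim/tensorW => s; rewrite /= F_funE; congr tpi.
by rewrite -[RHS]map_id; apply: eq_map => -[].
Qed.
Next Obligation.
move=> M N P g f; elim/tensorW => s; rewrite /= !F_funE; congr tpi.
by rewrite -map_comp.
Qed.

Lemma F_zeromor M N :
  fmap F_functor (zeromor M N : hom (M : Mod hecke_ring) N)
    =h zeromor (F_functor M) (F_functor N).
Proof.
elim/tensorW => s; rewrite /= F_funE; apply: tpiP.
elim: s => [|[x m] s IHs]; first exact: TRrefl.
rewrite /= -cat1s -[X in tensor_rel _ X]cat0s; apply: TRcat IHs.
rewrite -(scale0r (0 : N)); apply: TRtrans (TRsym (TRbal _ _ _)) _; exact: TR0.
Qed.

End HeckeModules.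

(** * The Frobenius category [C(G)] and the functor [FF] *)

Section FrobeniusCategory.
Variables (k : fieldType) (p : nat) (G : topGroupType).
Variable I : open_pro_p_subgroup p G.

Local Notation H := (hecke_ring k I).
Local Notation U := (U_functor k I).
Local Notation F := (F_functor k I).

Definition Rep_weq : mor_class (Rep k G) := fun V W f => Mod_weq (fmap U f).

Definition I_projective (V : Rep k G) :=
  exists P : Mod H, projective P /\
    exists (s : hom V (F P)) (r : hom (F P) V), r \c s =h idm V.

Definition I_exact (V1 V2 V3 : Rep k G) (f : hom V1 V2) (g : hom V2 V3) :=
  g \c f =h zeromor V1 V3 /\ exact_at (fmap U f) (fmap U g).

Definition in_CG (V : Rep k G) :=
  exists X : complex (Rep k G),
    [/\ forall n, I_projective (X n),
        forall n, I_exact (cd X (n + 1)) (cd X n)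
      & isomorphic V (rep_B0 k G X)].

Definition CG : category := full_sub in_CG.

(** Exactness of [0 -> x -> y -> z -> 0] after applying [U]. *)
Definition short_I_exact (x y z : CG) (f : hom x y) (g : hom y z) :=
  [/\ @I_exact (sval x) (sval y) (sval z) f g,
      injective (@fmap _ _ U (sval x) (sval y) f)
    & surjective_map (@fmap _ _ U (sval y) (sval z) g)].

Definition CG_projective (t : CG) :=
  forall (x y z : CG) (i : hom x y) (q : hom y z) (f : hom t z),
    short_I_exact i q -> exists g : hom t y, q \c g =h f.

(** The weak equivalences of the exact model structure in which all objects
  are bifibrant and the trivial objects are the projective ones: composites of
  an admissible monomorphism with trivial cokernel followed by an admissible
  epimorphism with trivial kernel. *)
Definition CG_weq : mor_class CG := fun x y f =>
  exists (e : CG) (j : hom x e) (q : hom e y),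
    [/\ f =h q \c j,
        exists (c : CG) (r : hom e c), short_I_exact j r /\ CG_projective c
      & exists (t : CG) (i : hom t e), short_I_exact i q /\ CG_projective t].

Definition CG_incl : functor CG (Rep k G) := @inclusion (Rep k G) in_CG.

Definition F_complex : functor (Ch (Mod H)) (Ch (Rep k G)) :=
  Ch_functor (@F_zeromor k p G I).

Definition FF (Y : functorial_resolution H) : functor (GProj H) (Rep k G) :=
  rep_B0 k G \of F_complex \of Y \of GProj_incl H.

End FrobeniusCategory.

(* Main.v *)
(** For a projective [H]-module [P] the unit [P -> U (F P)] is an isomorphism,
  since [U] commutes with direct sums and [End_G(X)^op = H].  Hence [U] turns an
  [I]-exact complex of [I]-projectives into an acyclic complex of projectives,
  which stays exact under [Hom(-, P)], [P] projective, because over a Gorenstein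
  ring projectives have finite injective dimension (Baer's criterion and the
  noetherian hypothesis handle infinite direct sums).  Extending a map
  [U V -> U W] to the terms of such complexes shows that [U] is fully faithful on
  [C(G)], with values in Gorenstein projective modules; moreover
  [U (FF M) = B_0 Y^M = M].

  A weak equivalence of modules induces bijections on stable morphisms (modulo
  maps factoring through projectives) out of Gorenstein projectives; between
  Gorenstein projectives this property characterizes the weak equivalences, and
  it has the cancellation properties needed for [Q].  A map [f : V -> W] of
  [C(G)] with [U f] a weak equivalence factors through [W (+) F P] by full
  faithfulness, so it is a weak equivalence of [C(G)].  As [U] preserves weak
  equivalences, [RU] is [Ho(U)], and the natural maps [U FF Q M = Q M -> M] and
  [FF Q U V -> V] are the required isomorphisms. *)

From HB Require Import structures.
From mathcomp Require Import all_boot all_order all_algebra monoid.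
From mathcomp Require Import boolp classical_sets functions topology.
Require Import Defs.

Set Implicit Arguments.
Unset Strict Implicit.
Unset Printing Implicit Defensive.

Import GRing.Theory.
Local Open Scope classical_set_scope.
Local Open Scope ring_scope.

(** * Linear maps *)

Section LinearMaps.
Variable R : pzRingType.
Implicit Types L M N P A B C D E K : lmodType R.

Lemma linear_exists M N (f : M -> N) :
  linear f -> exists g : {linear M -> N}, g =1 f.
Proof.
move=> fL.
pose g : {linear M -> N} := HB.pack f (GRing.isLinear.Build R M N _ f fL).
by exists g.
Qed.

Lemma injective_linear M N (f : {linear M -> N}) :
  (forall x, f x = 0 -> x = 0) -> injective f.
Proof. by move=> f0 x y /eqP; rewrite -subr_eq0 -raddfB => /eqP/f0/subr0_eq. Qed.

Lemma linear_inj0 M N (f : {linear M -> N}) x : injective f -> f x = 0 -> x = 0.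
Proof. by move=> fi fx; apply: fi; rewrite fx raddf0. Qed.

(** Preimages under an injective [j] are unique, so choosing them pointwise already yields a linear
    map. *)
Lemma factor_mono L A M (j : {linear L -> A}) (f : {linear M -> A}) :
  injective j -> (forall m, exists l, j l = f m) ->
  exists g : {linear M -> L}, j \o g =1 f.
Proof.
move=> ji /choice [g gP].
have [a x y|g' g'E] := @linear_exists M L g.
  by apply: ji; rewrite linearP !gP linearP.
by exists g' => x /=; rewrite g'E gP.
Qed.

(** A chosen section of [q] need not be linear, but [f] is constant on the fibres of [q], so its
    composite with the section is. *)
Lemma factor_epi A B N (q : {linear A -> B}) (f : {linear A -> N}) :
  surjective_map q -> (forall a, q a = 0 -> f a = 0) ->
  exists g : {linear B -> N}, g \o q =1 f.
Proof.
move=> /choice [s sP] f0.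
have fE a b : q a = q b -> f a = f b.
  by move=> /eqP; rewrite -subr_eq0 -raddfB => /eqP/f0; rewrite raddfB => /subr0_eq.
have [a x y|g' g'E] := @linear_exists B N (f \o s).
  by rewrite /= -linearP; apply: fE; rewrite linearP !sP.
by exists g' => x /=; rewrite g'E /=; apply: fE; rewrite sP.
Qed.

Lemma linear_inverse M N (f : {linear M -> N}) :
  injective f -> surjective_map f ->
  exists g : {linear N -> M}, cancel f g /\ cancel g f.
Proof.
move=> fi fs; have [g gP] := @factor_mono M N N f idfun fi fs.
by exists g; split=> [x|x]; [apply: fi|]; exact: gP.
Qed.

Lemma linear_pair L M N (f : {linear L -> M}) (g : {linear L -> N}) :
  exists h : {linear L -> (M * N)%type}, forall x, h x = (f x, g x).
Proof. by apply: linear_exists => a x y; rewrite !linearP. Qed.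

Lemma image_factor A B (d : {linear A -> B}) :
  exists c : {linear A -> sm_type (image_sub d)},
    (forall x, val (c x) = d x) /\ surjective_map c.
Proof.
have [|c cP] := @factor_mono _ _ _ (\val : {linear sm_type (image_sub d) -> B}) d
  val_inj.
  move=> a; have da : d a \in sm_pred (image_sub d) by apply/asboolP; exists a.
  by exists (exist _ (d a) da).
exists c; split=> // y; have /asboolP [x _ xy] := valP y.
by exists x; apply: val_inj; rewrite -xy; exact: cP.
Qed.

(** The map [f] descends to the image of [d], a submodule of [B], and injectivity of [E] extends it
    from there. *)
Lemma injective_extend A B E (d : {linear A -> B}) (f : {linear A -> E}) :
  injective_module E -> (forall a, d a = 0 -> f a = 0) ->
  exists g : {linear B -> E}, g \o d =1 f.
Proof.
move=> Ei f0; have [c [cE cs]] := image_factor d.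
have [|h hE] := @factor_epi _ _ _ c f cs.
  by move=> a ca; apply: f0; rewrite -cE ca raddf0.
have [g gE] := Ei _ _ (\val : {linear sm_type (image_sub d) -> B}) h val_inj.
by exists g => a /=; rewrite -cE; move: (gE (c a)) (hE a) => /= -> ->.
Qed.

Program Definition ker_sub M N (f : {linear M -> N}) : submodule M :=
  @Submodule R M [set x | f x = 0] _ _ _.
Next Obligation. by move=> M N f /=; rewrite raddf0. Qed.
Next Obligation. by move=> M N f x y /= fx fy; rewrite raddfD /= fx fy addr0. Qed.
Next Obligation. by move=> M N f a x /= fx; rewrite linearZ /= fx scaler0. Qed.

Lemma ker_exact M N (f : {linear M -> N}) :
  exact_at (\val : {linear sm_type (ker_sub f) -> M}) f.
Proof.
move=> y; split=> [fy|[x <-]]; last by have /asboolP := valP x.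
have yk : y \in sm_pred (ker_sub f) by apply/asboolP.
by exists (exist _ y yk).
Qed.

Lemma retract_projective P M (s : {linear M -> P}) (r : {linear P -> M}) :
  cancel s r -> projective P -> projective M.
Proof.
move=> sr Pp A B q f qs; have [g gP] := Pp A B q (f \o r) qs.
by exists (g \o s) => x /=; move: (gP (s x)) => /= ->; rewrite sr.
Qed.

Lemma prod_projective P M : projective P -> projective M ->
  projective (P * M)%type.
Proof.
move=> Pp Mp A B q f qs.
have [i1 i1E] := linear_pair (idfun : {linear P -> P}) (\0 : {linear P -> M}).
have [i2 i2E] := linear_pair (\0 : {linear M -> P}) (idfun : {linear M -> M}).
have [g1 g1E] := Pp A B q (f \o i1) qs.
have [g2 g2E] := Mp A B q (f \o i2) qs.
exists ((g1 \o fst) \+ (g2 \o snd)) => -[x y] /=.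
move: (g1E x) (g2E y) => /=; rewrite raddfD /= => -> ->.
by rewrite -raddfD i1E i2E /=; congr (f _); congr (_, _); rewrite /= ?addr0 ?add0r.
Qed.

End LinearMaps.

(** * Injective modules over a noetherian ring *)

Section Baer.
Variables (R : pzRingType) (E : lmodType R).

(** A maximal partial extension, as the graph of a partial map, is total:
  otherwise the hypothesis for the ideal [{r | r x in the domain}] extends it
  to a further element [x]. *)
Lemma baer_criterion :
  (forall (J : submodule R^o) (f : {linear sm_type J -> E}),
    exists e, forall r, f r = (val r : R) *: e) ->
  injective_module E.
Proof.
move=> bE M N j f ji.
(* These are the graphs of linear maps from submodules of [N] to [E] that extend [f] along [j]. *)
pose good (A : set (N * E)) := [/\ forall m, A (j m, f m),
  forall a x y, A x -> A y -> A (a *: x.1 + y.1, a *: x.2 + y.2)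
  & forall e, A (0, e) -> e = 0].
have [F FP Ftot|A [AP Amax]] := @Zorn_bigcup (N * E)%type [set A | A = set0 \/ good A].
  have [[X FX [x Xx]]|F0] := pselect (exists2 X, F X & X !=set0); last first.
    left; apply/seteqP; split=> // x [X FX Xx]; apply: F0; exists X => //.
    by exists x.
  right; have goodF Y y : F Y -> Y y -> good Y.
    by move=> /FP [->|].
  have [X1 X2 X3] := goodF _ _ FX Xx.
  split=> [m|a y z [Y FY Yy] [Z FZ Zz]|e [Y FY Ye]].
  - by exists X.
  - have [YZ|ZY] := Ftot _ _ FY FZ.
      by exists Z => //; have [_ Z2 _] := goodF _ _ FZ Zz; apply: Z2 => //; apply: YZ.
    by exists Y => //; have [_ Y2 _] := goodF _ _ FY Yy; apply: Y2 => //; apply: ZY.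
  - by have [_ _ Y3] := goodF _ _ FY Ye; apply: Y3.
have {AP} [A1 A2 A3] : good A.
  case: AP => // A0; case: (Amax [set x | exists m, x = (j m, f m)]).
    rewrite A0; split=> [//|/(_ (j 0, f 0))]; apply; by exists 0.
  right; split=> [m|a _ _ [m ->] [n ->] /=|e [m [/esym]]].
  - by exists m.
  - by exists (a *: m + n); rewrite !linearP.
  - by move=> /(linear_inj0 ji) -> ->; rewrite raddf0.
have A0 : A (0, 0) by have := A1 0; rewrite !raddf0.
have AZ a x e : A (x, e) -> A (a *: x, a *: e).
  by move=> Ax; have := A2 a _ _ Ax A0; rewrite /= !addr0.
have AD x e y e' : A (x, e) -> A (y, e') -> A (x + y, e + e').
  by move=> Ax Ay; have := A2 1 _ _ Ax Ay; rewrite /= !scale1r.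
have AN x e : A (x, e) -> A (- x, - e) by move/(AZ (-1)); rewrite !scaleN1r.
have Afun x e e' : A (x, e) -> A (x, e') -> e = e'.
  move=> xe /AN xe'; apply: subr0_eq; apply: A3; rewrite -(subrr x).
  exact: AD.
suff dom x : exists e, A (x, e).
  have [g gP] := choice dom.
  have [a x y|g' g'E] := @linear_exists R N E g.
    by apply: (Afun (a *: x + y)) => //; apply: AD => //; exact: AZ.
  by exists g' => m /=; rewrite g'E; exact: Afun (gP _) (A1 m).
apply: contrapT => xA.
pose J : submodule R^o := @Submodule R R^o [set r : R | exists e, A (r *: x, e)]
  ltac:(by exists 0; rewrite scale0r)
  ltac:(by move=> r r' [e re] [e' re']; exists (e + e'); rewrite scalerDl; exact: AD)
  ltac:(by move=> a r [e re]; exists (a *: e); rewrite -scalerA; exact: AZ).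
have /choice [h hP] : forall r : sm_type J, exists e, A ((val r : R) *: x, e).
  by move=> r; have /asboolP := valP r.
have [a r s|h' h'E] := @linear_exists R (sm_type J) E h.
  apply: Afun (hP _) _; rewrite linearP scalerDl /=.
  by apply: (@AD _ _ _ _ _ (hP s)); rewrite -scalerA; exact: (@AZ a _ _ (hP r)).
have [e eP] := bE J h'.
have Je r e' : A (r *: x, e') -> e' = r *: e.
  move=> re'; have rJ : (r : R^o) \in sm_pred J by apply/asboolP; exists e'.
  by apply: Afun re' _; rewrite -(eP (exist _ r rJ)) h'E; exact: (hP (exist _ r rJ)).
(* The graph is enlarged by [x |-> e]. It stays single-valued since, by [Je], the old map already
   sends [r *: x] to [r *: e] wherever it is defined. *)
apply: (Amax [set z | exists y r e', A (y, e') /\ z = (y + r *: x, e' + r *: e)]).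
  split=> [[y e'] ye' /=|BA].
    by exists y, 0, e'; rewrite !scale0r !addr0.
  apply: xA; exists e; apply: BA; exists 0, 1, 0; split=> //.
  by rewrite !scale1r !add0r.
right; split=> [m|a _ _ [y [r [e1 [y1 ->]]]] [y' [r' [e2 [y2 ->]]]] /=|e'].
- by exists (j m), 0, (f m); rewrite !scale0r !addr0.
- exists (a *: y + y'), (a * r + r'), (a *: e1 + e2); split; first exact: A2 y1 y2.
  by rewrite !scalerDr !scalerDl !scalerA; congr (_, _); rewrite addrACA.
- move=> [y [r [e1 [y1 [/esym/eqP yr ->]]]]].
  move: yr; rewrite addrC addr_eq0 => /eqP yr.
  by rewrite -(Je r (- e1)) ?subrr // yr; exact: AN.
Qed.

End Baer.

(** * Direct sums and free modules *)

Section DirectSum.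
Variable R : pzRingType.
Implicit Types (S : choiceType) (M N E P : lmodType R).

Program Definition dsum_sub S M : submodule (S -> M) :=
  @Submodule R (S -> M) [set f | exists s : seq S, forall x, x \notin s -> f x = 0]
    _ _ _.
Next Obligation. by move=> S M; exists [::]. Qed.
Next Obligation.
move=> S M f g [s fs] [t gt]; exists (s ++ t) => x.
by rewrite mem_cat negb_or !fctE => /andP [/fs -> /gt ->]; rewrite addr0.
Qed.
Next Obligation.
move=> S M a f [s fs]; exists s => x /fs fx.
by rewrite -[LHS]/(a *: f x) fx scaler0.
Qed.

Definition dsum S M : lmodType R := sm_type (dsum_sub S M).

Lemma dsumP S M (f : dsum S M) :
  exists s : seq S, forall x, x \notin s -> val f x = 0.
Proof. by have /asboolP := valP f. Qed.

Lemma dsum_valP S M a (f g : dsum S M) x :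
  val (a *: f + g) x = a *: val f x + val g x.
Proof. by rewrite sm_valP. Qed.

Lemma dsum_intro S M (f : S -> M) (s : seq S) :
  (forall x, x \notin s -> f x = 0) -> exists g : dsum S M, val g = f.
Proof.
move=> fs; have fP : f \in sm_pred (dsum_sub S M) by apply/asboolP; exists s.
by exists (exist _ f fP).
Qed.

Lemma dsum_map S M N (f : {linear M -> N}) :
  exists F : {linear dsum S M -> dsum S N},
    forall x s, val (F x) s = f (val x s).
Proof.
have /choice [F FP] : forall x : dsum S M, exists y : dsum S N,
    forall s, val y s = f (val x s).
  move=> x; have [s xs] := dsumP x.
  have [t /xs ->|y yE] := @dsum_intro S N (fun t => f (val x t)) s.
    exact: raddf0.
  by exists y => t; rewrite yE.
have [a x y|F' F'E] := @linear_exists R _ _ F; last by exists F' => x s; rewrite F'E.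
by apply: val_inj; apply/funext => s; rewrite dsum_valP !FP dsum_valP linearP.
Qed.

Lemma dsum_coord S M s : exists c : {linear dsum S M -> M}, forall x, c x = val x s.
Proof. by apply: linear_exists => a x y; exact: dsum_valP. Qed.

(** Coordinatewise preimages keep finite support: those under [j] are unique, and those under [q]
    are chosen zero off the support. *)
Lemma dsum_short_exact S M N P (j : {linear M -> N}) (q : {linear N -> P}) :
  short_exact j q -> exists (J : {linear dsum S M -> dsum S N})
    (Q : {linear dsum S N -> dsum S P}), short_exact J Q.
Proof.
move=> [ji jq qs]; have [J JE] := dsum_map S j; have [Q QE] := dsum_map S q.
exists J, Q; split.
- move=> x y xy; apply: val_inj; apply/funext => s; apply: ji.
  by rewrite -!JE xy.
- move=> y; split=> [Qy|[x <-]]; last first.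
    by apply: val_inj; apply/funext => s; rewrite QE JE; apply/jq; exists (val x s).
  have /choice [h hP] : forall s, exists m, j m = val y s.
    by move=> s; apply/jq; rewrite -QE Qy.
  have [s ys] := dsumP y.
  have [t /ys yt|x xE] := @dsum_intro S M h s.
    by apply: (linear_inj0 ji); rewrite hP.
  by exists x; apply: val_inj; apply/funext => t; rewrite JE xE hP.
- move=> y; have [s ys] := dsumP y.
  have /choice [h hP] : forall t, exists n, (t \notin s -> n = 0) /\ q n = val y t.
    move=> t; have [ts|/ys ->] := boolP (t \in s).
      by have [n nE] := qs (val y t); exists n.
    by exists 0; rewrite raddf0.
  have [t /(hP t).1 //|x xE] := @dsum_intro S N h s.
  by exists x; apply: val_inj; apply/funext => t; rewrite QE xE (hP t).2.
Qed.

(** If the image of an ideal [J] met infinitely many summands, the ideals of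
  the elements supported on a growing finite set of indices would form a
  strictly ascending chain. *)
Lemma dsum_injective S E : left_noetherian R -> injective_module E ->
  injective_module (dsum S E).
Proof.
move=> noeth Ei; apply: baer_criterion => J f.
pose supp (s : seq S) (r : sm_type J) := forall x, x \notin s -> val (f r) x = 0.
have [s sP] : exists s, forall r, supp s r.
  apply: contrapT => /forallNP nP.
  have /choice [b bP] s : exists r, ~ supp s r by apply/existsNP.
  have /choice [c cP] r : exists s, supp s r := dsumP (f r).
  (* Each step adds the support of the image of [b (s n)], an element of [J] whose image is not
     supported on [s n]. *)
  pose s := fix s n := if n is m.+1 then s m ++ c (b (s m)) else [::].
  pose Js n : submodule R^o := @Submodule R R^o
    [set r : R | exists2 r' : sm_type J, (val r' : R) = r & supp (s n) r']
    ltac:(by exists 0 => // x _; rewrite raddf0)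
    ltac:(by move=> _ _ [r <- rs] [r' <- r's]; exists (r + r') => // x xs;
      rewrite raddfD -[LHS]/(val (f r) x + val (f r') x) rs // r's // addr0)
    ltac:(by move=> a _ [r <- rs]; exists (a *: r) => // x xs;
      rewrite linearZ -[LHS]/(a *: (val (f r) x)) rs // scaler0).
  have [n|m mP] := noeth Js.
    move=> r [r' r'E r's]; exists r' => // x; rewrite mem_cat negb_or => /andP [xs _].
    exact: r's.
  have : sm_set (Js m) (val (b (s m))).
    rewrite -(mP m.+1) //; exists (b (s m)) => // x.
    by rewrite mem_cat negb_or => /andP [_]; exact: cP.
  by move=> [r' /val_inj ->]; exact: bP.
(* For an index in [s], injectivity of [E] extends the coordinate of [f] to a map [g] on [R], which
   is multiplication of [g 1] by scalars. *)
have /choice [e eP] : forall x, exists e : E, (x \notin s -> e = 0) /\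
    forall r, val (f r) x = (val r : R) *: e.
  move=> x; have [xs|xs] := boolP (x \in s); last first.
    by exists 0; split=> // r; rewrite sP // scaler0.
  have [c cE] := dsum_coord E x.
  have [g gE] := Ei _ _ (\val : {linear sm_type J -> R^o}) (c \o f) val_inj.
  exists (g 1); split=> // r; rewrite -linearZ -cE -[LHS](gE r) /=; congr (g _).
  exact: esym (mulr1 _).
have [x|y yE] := @dsum_intro S E e s; first exact: (eP x).1.
exists y => r; apply: val_inj; apply/funext => x.
by rewrite (eP x).2 -yE.
Qed.

Lemma dsum_finite_injdim S M : left_noetherian R -> finite_injdim M ->
  finite_injdim (dsum S M).
Proof.
move=> noeth; elim=> [E Ei|M' E N j q jq Ei _ IH].
  exact/injdim0/dsum_injective.
have [J [Q JQ]] := dsum_short_exact S jq.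
by apply: injdimS JQ _ IH; exact: dsum_injective.
Qed.

(** The free module on the underlying set of [P] maps onto [P], and projectivity splits this map.
    The formula for [r] later expands tensors in coordinates. *)
Lemma projective_retract_free P : projective P ->
  exists (S : choiceType) (i : {linear P -> dsum S R^o})
    (r : {linear dsum S R^o -> P}) (b : S -> P),
    cancel i r /\ forall x s, uniq s -> (forall t, t \notin s -> val x t = 0) ->
      r x = \sum_(t <- s) (val x t : R) *: b t.
Proof.
move=> Pp; pose S : choiceType := P; exists S.
pose b (t : S) : P := t.
have fE (x : dsum S R^o) s t : uniq s -> uniq t ->
    (forall u, u \notin s -> val x u = 0) -> (forall u, u \notin t -> val x u = 0) ->
    \sum_(u <- s) (val x u : R) *: b u = \sum_(u <- t) (val x u : R) *: b u.
  (* Any two lists containing the support give the same sum, as both can be enlarged to their union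
     by zero terms. *)
  have sub s' t' : uniq s' -> uniq t' -> {subset s' <= t'} ->
      (forall u, u \notin s' -> val x u = 0) ->
      \sum_(u <- t') (val x u : R) *: b u = \sum_(u <- s') (val x u : R) *: b u.
    move=> us' ut' st xs'; rewrite (bigID (mem s')) /= [X in _ + X]big1 ?addr0.
      rewrite -big_filter; apply: perm_big; apply: uniq_perm => //.
        exact: filter_uniq.
      by move=> u; rewrite mem_filter andb_idr //; exact: st.
    by move=> u /xs' ->; rewrite scale0r.
  move=> us ut xs xt; rewrite -(sub s (undup (s ++ t))) ?undup_uniq //.
    rewrite -(sub t (undup (s ++ t))) ?undup_uniq // => u ut'.
    by rewrite mem_undup mem_cat ut' orbT.
  by move=> u us'; rewrite mem_undup mem_cat us'.
have /choice [r rP] : forall x : dsum S R^o, exists m, forall s, uniq s ->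
    (forall u, u \notin s -> val x u = 0) -> m = \sum_(u <- s) (val x u : R) *: b u.
  move=> x; have [s xs] := dsumP x; exists (\sum_(u <- undup s) (val x u : R) *: b u).
  by move=> t ut xt; apply: fE; rewrite ?undup_uniq // => u; rewrite mem_undup; exact: xs.
have [a x y|r' r'E] := @linear_exists R _ _ r.
  have [s xs] := dsumP x; have [t yt] := dsumP y.
  have us := undup_uniq (s ++ t).
  have cE u : val (a *: x + y) u = (a : R) * val x u + val y u by exact: dsum_valP.
  rewrite !(rP _ _ us).
  - rewrite scaler_sumr -big_split /=; apply: eq_bigr => u _.
    by rewrite [X in X *: _]cE scalerDl -scalerA.
  - by move=> u; rewrite mem_undup mem_cat negb_or => /andP [_]; exact: yt.
  - by move=> u; rewrite mem_undup mem_cat negb_or => /andP []; move/xs.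
  - move=> u; rewrite mem_undup mem_cat negb_or => /andP [/xs xu /yt yu].
    by apply: etrans (cE u) _; rewrite xu yu mulr0 addr0.
have [|i iE] := Pp _ _ r' idfun.
  move=> m; have [u|x xE] := @dsum_intro S R^o (fun u => (u == m)%:R) [:: m].
    by rewrite inE => /negPf ->.
  exists x; rewrite r'E (rP _ [:: m]) //.
    by rewrite big_seq1 xE eqxx scale1r.
  by move=> u; rewrite inE xE => /negPf ->.
exists i, r', b; split=> [|x s us xs]; first exact: iE.
by rewrite r'E; exact: rP.
Qed.

End DirectSum.

(** * Gorenstein projective modules and stable equivalences *)

Section GorensteinProjective.
Variable R : pzRingType.
Implicit Types (L M N P A B C D E K : lmodType R) (X : complex (Mod R)).

(** Exactness of [Hom(X, P)] for one target, isolated so that inductions can run over resolutions of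
    [P]. *)
Definition hom_exact X P :=
  forall n (phi : {linear X (n + 1) -> P}), (forall x, phi (cd X (n + 1) x) = 0) ->
    exists psi : {linear X n -> P}, psi \o cd X n =1 phi.

Lemma hom_exact_retract X P P' (s : {linear P -> P'}) (r : {linear P' -> P}) :
  cancel s r -> hom_exact X P' -> hom_exact X P.
Proof.
move=> sr XP n phi phi0; have [x|psi psiE] := XP n (s \o phi).
  by rewrite /= phi0 raddf0.
by exists (r \o psi) => x; move: (psiE x) => /= ->; rewrite sr.
Qed.

(** Dimension shifting along an injective resolution: an extension of [j \o phi] to [E] is corrected
    by a lift of the map into [N] obtained by induction, and then lands in [M]. *)
Lemma hom_exact_injdim X P : (forall n, projective (X n)) -> acyclic X ->
  finite_injdim P -> hom_exact X P.
Proof.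
move=> Xp Xa; elim=> [{}P Pi|M E N j q [ji jq qs] Ei _ IH] n.
  move=> phi phi0; apply: injective_extend Pi _ => x /Xa [y <-]; exact: phi0.
(* The correcting map starts one degree lower than the extension, whence the shift of index. *)
have [m ->] : exists m, n = m + 1 by exists (n - 1); rewrite subrK.
move=> {n} phi phi0.
have [x /Xa [y <-]|psi psiE] := injective_extend (d := cd X (m + 1)) (f := j \o phi) Ei.
  by rewrite /= phi0 raddf0.
have [x|chi chiE] := IH m (q \o psi).
  by move: (psiE x) => /= ->; apply/jq; exists (phi x).
have [chi' chi'E] := Xp m _ _ q chi qs.
have [|psi' psi'E] := @factor_mono _ _ _ _ j (psi \- (chi' \o cd X m)) ji.
  move=> x; apply/jq; rewrite raddfB /=.
  by move: (chi'E (cd X m x)) (chiE x) => /= -> ->; rewrite subrr.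
exists psi' => x /=; apply: ji; move: (psi'E (cd X (m + 1) x)) (psiE x) => /= -> ->.
have -> : cd X m (cd X (m + 1) x) = 0 by exact: (cdd X m x).
by rewrite raddf0 subr0.
Qed.

(** A projective is a retract of a direct sum of copies of [R], which has finite injective dimension
    by the noetherian hypothesis. *)
Lemma Gorenstein_hom_exact X P : Gorenstein_ring R ->
  (forall n, projective (X n)) -> acyclic X -> projective P -> hom_exact X P.
Proof.
move=> [noeth _ Ri _] Xp Xa Pp.
have [S [i [r [_ [ir _]]]]] := projective_retract_free Pp.
apply: hom_exact_retract ir _; apply: hom_exact_injdim => //.
exact: dsum_finite_injdim.
Qed.

(** Induction on a projective resolution: a lift of [phi] to [P] fails to kill boundaries by a map
    into [K'], which the induction hypothesis lets one subtract. *)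
Lemma hom_exact_projdim X K : (forall n, projective (X n)) -> acyclic X ->
  (forall P, projective P -> hom_exact X P) -> finite_projdim K -> hom_exact X K.
Proof.
move=> Xp Xa XP; elim=> [P /XP //|K' P M j q [ji jq qs] Pp _ IH] n phi phi0.
have [phi' phi'E] := Xp (n + 1) _ _ q phi qs.
have [|chi chiE] := @factor_mono _ _ _ _ j (phi' \o cd X (n + 1)) ji.
  move=> x; apply/jq; move: (phi'E (cd X (n + 1) x)) => /= ->; exact: phi0.
have [x|chi' chi'E] := IH (n + 1) chi.
  apply: (linear_inj0 ji); move: (chiE (cd X (n + 1 + 1) x)) => /= ->.
  have -> : cd X (n + 1) (cd X (n + 1 + 1) x) = 0 by exact: (cdd X (n + 1) x).
  exact: raddf0.
have [x|psi psiE] := XP P Pp n (phi' \- (j \o chi')).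
  by move: (chi'E x) (chiE x) => /= -> ->; rewrite subrr.
exists (q \o psi) => x; move: (psiE x) => /= ->; rewrite raddfB /=.
move: (phi'E x) => /= ->; have -> : q (j (chi' x)) = 0 by apply/jq; exists (chi' x).
by rewrite subr0.
Qed.

(** Replaces the image type [B0 X] by a factorization of the differential through [M], and widens
    the test modules to finite projective dimension. *)
Lemma Gorenstein_projective_res M : Gorenstein_projective M ->
  exists (X : complex (Mod R)) (c : {linear X (0 + 1) -> M}) (e : {linear M -> X 0}),
    [/\ forall n, projective (X n), acyclic X,
        forall K, finite_projdim K -> hom_exact X K,
        surjective_map c & injective e /\ forall x, e (c x) = cd X 0 x].
Proof.
move=> [X [Xp Xa XP [f [g [gf fg]]]]].
have [c [cE cs]] := image_factor (cd X 0).
exists X, (g \o c), (\val \o f : {linear M -> X 0}); split=> //.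
- by move=> K; apply: hom_exact_projdim.
- by move=> y; have [x xE] := cs (f y); exists x; rewrite /= xE; exact: gf.
- split=> [x y /= /val_inj xy|x /=]; last by rewrite -cE; congr val; exact: fg.
  by rewrite -[x]gf -[y]gf /= xy.
Qed.

(** This is the vanishing of [Ext^1(M, L)]. A lift of [g \o c] to [A] is corrected by a map into [L]
    until it kills the kernel of [c], and then descends to [M]. *)
Lemma Gorenstein_projective_lift M L A B (j : {linear L -> A}) (q : {linear A -> B})
    (g : {linear M -> B}) :
  Gorenstein_projective M -> short_exact j q -> finite_projdim L ->
  exists h : {linear M -> A}, q \o h =1 g.
Proof.
move=> /Gorenstein_projective_res [X [c [e [Xp Xa XK cs [ei ecE]]]]] [ji jq qs] /XK XL.
have [a aE] := Xp (0 + 1) _ _ q (g \o c) qs.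
have c0 x : c (cd X (0 + 1) x) = 0.
  by apply: (linear_inj0 ei); rewrite ecE; exact: (cdd X 0 x).
have [|chi chiE] := @factor_mono _ _ _ _ j (a \o cd X (0 + 1)) ji.
  move=> x; apply/jq; move: (aE (cd X (0 + 1) x)) => /= ->.
  by rewrite c0 raddf0.
have [x|chi' chi'E] := XL (0 + 1) chi.
  apply: (linear_inj0 ji); move: (chiE (cd X (0 + 1 + 1) x)) => /= ->.
  have -> : cd X (0 + 1) (cd X (0 + 1 + 1) x) = 0 by exact: (cdd X (0 + 1) x).
  exact: raddf0.
have [x cx|h hE] := factor_epi (f := a \- (j \o chi')) cs.
  have : cd X 0 x = 0 by rewrite -ecE cx raddf0.
  by move/Xa => [y <-]; move: (chi'E y) (chiE y) => /= -> ->; rewrite subrr.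
exists h => y; have [x <-] := cs y; move: (hE x) => /= ->.
rewrite raddfB /=; move: (aE x) => /= ->.
have -> : q (j (chi' x)) = 0 by apply/jq; exists (chi' x).
by rewrite subr0.
Qed.

(** [f] vanishes in the stable category. *)
Definition projectively_trivial M N (f : {linear M -> N}) :=
  exists (P : lmodType R) (a : {linear M -> P}) (b : {linear P -> N}),
    projective P /\ b \o a =1 f.

Local Notation ptriv := projectively_trivial.

Lemma ptriv_eq M N (f g : {linear M -> N}) : f =1 g -> ptriv f -> ptriv g.
Proof. by move=> fg [P [a [b [Pp ab]]]]; exists P, a, b; split=> // x; rewrite ab. Qed.

Lemma ptriv_via M N P (a : {linear M -> P}) (b : {linear P -> N}) :
  projective P -> ptriv (b \o a).
Proof. by move=> Pp; exists P, a, b. Qed.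

Lemma ptriv_compl M N A (f : {linear M -> N}) (g : {linear N -> A}) :
  ptriv f -> ptriv (g \o f).
Proof.
move=> [P [a [b [Pp ab]]]]; exists P, a, (g \o b); split=> // x /=.
by move: (ab x) => /= ->.
Qed.

Lemma ptriv_compr M N A (f : {linear M -> N}) (g : {linear A -> M}) :
  ptriv f -> ptriv (f \o g).
Proof.
move=> [P [a [b [Pp ab]]]]; exists P, (a \o g), b; split=> // x /=.
by move: (ab (g x)) => /= ->.
Qed.

Lemma ptrivD M N (f g : {linear M -> N}) : ptriv f -> ptriv g -> ptriv (f \+ g).
Proof.
move=> [P [a [b [Pp ab]]]] [P' [a' [b' [P'p ab']]]].
have [c cE] := linear_pair a a'.
exists (P * P')%type, c, ((b \o fst) \+ (b' \o snd)); split=> [|x /=].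
  exact: prod_projective.
by rewrite cE /=; move: (ab x) (ab' x) => /= -> ->.
Qed.

Lemma ptrivN M N (f : {linear M -> N}) : ptriv f -> ptriv (\- f).
Proof.
move=> [P [a [b [Pp ab]]]]; exists P, a, (\- b); split=> // x /=.
by move: (ab x) => /= ->.
Qed.

Lemma ptriv0 M N : ptriv (\0 : {linear M -> N}).
Proof.
(* The kernel of the identity serves as the zero module, which is projective. *)
have z (x : sm_type (ker_sub (idfun : {linear M -> M}))) : x = 0.
  by apply: val_inj; apply/(ker_exact idfun); exists x.
exists (sm_type (ker_sub (idfun : {linear M -> M}))), \0, \0; split=> // A B q f _.
by exists \0 => x; rewrite [x]z !raddf0.
Qed.

Lemma ptriv_id_projective M : ptriv (idfun : {linear M -> M}) -> projective M.
Proof. by move=> [P [a [b [Pp ab]]]]; apply: retract_projective Pp; exact: ab. Qed.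

(** Exactness of [Hom(X, K)] extends [f] along the embedding of [M] into the projective [X 0]. *)
Lemma ptriv_Gproj_projdim M K (f : {linear M -> K}) :
  Gorenstein_projective M -> finite_projdim K -> ptriv f.
Proof.
move=> /Gorenstein_projective_res [X [c [e [Xp Xa XK cs [ei ecE]]]]] /XK XL.
have [x|psi psiE] := XL 0 (f \o c).
  apply: etrans (congr1 f _) (raddf0 f); apply: (linear_inj0 ei).
  by rewrite ecE; exact: (cdd X 0 x).
exists (X 0), e, psi; split=> // y; have [x <-] := cs y.
by move: (psiE x) => /=; rewrite ecE.
Qed.

(** Bijectivity of composition with [f] on Hom groups modulo maps through projectives; injectivity
    is stated as a trivial kernel. *)
Definition stable_bijection M N (f : {linear M -> N}) :=
  forall E, Gorenstein_projective E ->
    (forall g : {linear E -> N}, exists h : {linear E -> M}, ptriv ((f \o h) \- g)) /\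
    (forall h : {linear E -> M}, ptriv (f \o h) -> ptriv h).

Lemma stable_bijection_eq M N (f g : {linear M -> N}) : f =1 g ->
  stable_bijection f -> stable_bijection g.
Proof.
move=> fg fb E /fb [fs fi]; split=> [u|h gh].
  by have [h hP] := fs u; exists h; apply: ptriv_eq hP => x /=; rewrite fg.
by apply: fi; apply: ptriv_eq gh => x /=; rewrite fg.
Qed.

Lemma stable_bijection_comp L M N (f : {linear L -> M}) (g : {linear M -> N}) :
  stable_bijection f -> stable_bijection g -> stable_bijection (g \o f).
Proof.
move=> fb gb E Eg; have [fs fi] := fb E Eg; have [gs gi] := gb E Eg.
split=> [u|h gfh]; last by apply: fi; apply: gi; apply: ptriv_eq gfh.
have [h hP] := gs u; have [h' h'P] := fs h; exists h'.
apply: ptriv_eq (ptrivD (ptriv_compl g h'P) hP) => x /=.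
by rewrite raddfB /= addrA subrK.
Qed.

Lemma stable_bijection_cancel L M N (f : {linear L -> M}) (g : {linear M -> N}) :
  stable_bijection g -> stable_bijection (g \o f) -> stable_bijection f.
Proof.
move=> gb gfb E Eg; have [gs gi] := gb E Eg; have [gfs gfi] := gfb E Eg.
split=> [u|h fh]; last first.
  by apply: gfi; apply: ptriv_eq (ptriv_compl g fh).
have [h hP] := gfs (g \o u); exists h; apply: gi; apply: ptriv_eq hP => x /=.
by rewrite raddfB.
Qed.

Lemma iso_stable_bijection M N (f : {linear M -> N}) :
  injective f -> surjective_map f -> stable_bijection f.
Proof.
move=> fi fs E _; have [f' [ff' f'f]] := linear_inverse fi fs.
split=> [u|h fh].
  exists (f' \o u); apply: ptriv_eq (ptriv0 _ _) => x /=.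
  by rewrite f'f subrr.
by apply: ptriv_eq (ptriv_compl f' fh) => x /=; rewrite ff'.
Qed.

Lemma is_iso_stable_bijection M N (f : @hom (Mod R) M N) :
  is_iso f -> stable_bijection f.
Proof.
move=> [g [gf fg]]; apply: iso_stable_bijection => [x y xy|y].
  by rewrite -[x]gf -[y]gf /= xy.
by exists ((g : {linear N -> M}) y); exact: fg.
Qed.

Lemma split_epi M E C (j : {linear M -> E}) (c : {linear E -> C}) :
  short_exact j c -> projective C ->
  exists (r : {linear E -> M}) (s : {linear C -> E}),
    cancel j r /\ forall x, j (r x) + s (c x) = x.
Proof.
move=> [ji jc cs] Cp; have [s sE] := Cp _ _ c idfun cs.
have [|r rE] := @factor_mono _ _ _ _ j (idfun \- (s \o c)) ji.
  by move=> a; apply/jc; rewrite raddfB /=; move: (sE (c a)) => /= ->; rewrite subrr.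
exists r, s; split=> x; last by move: (rE x) => /= ->; rewrite subrK.
apply: ji; move: (rE (j x)) => /= ->; suff -> : c (j x) = 0 by rewrite raddf0 subr0.
by apply/jc; exists x.
Qed.

(** The monomorphism splits with projective complement. Maps from [E] lift along the epimorphism
    because its kernel has finite projective dimension, and maps from [E] into that kernel are
    stably trivial. *)
Lemma weq_stable_bijection M N (f : {linear M -> N}) :
  Mod_weq f -> stable_bijection f.
Proof.
move=> [D [j [q [fE [C [c [jc Cp]]] [K [i [iq Kf]]]]]]] E Eg.
have [r [s [jr rsE]]] := split_epi jc Cp.
split=> [g|h [P [a [b [Pp ab]]]]].
  have [h hE] := Gorenstein_projective_lift g Eg iq Kf.
  exists (r \o h); apply: ptriv_eq (ptriv_via (c \o h) (\- (q \o s)) Cp) => x /=.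
  rewrite fE -(hE x) /= -[X in _ = _ - q X](rsE (h x)).
  by rewrite raddfD opprD addrA subrr add0r.
have [ii iqE qs] := iq; have [b' b'E] := Pp _ _ q b qs.
have [|k kE] := @factor_mono _ _ _ _ i ((j \o h) \- (b' \o a)) ii.
  move=> x; apply/iqE; rewrite raddfB /=.
  by move: (b'E (a x)) (ab x) => /= -> ->; rewrite fE subrr.
apply: ptriv_eq (ptriv_compl r (ptrivD (ptriv_compl i (ptriv_Gproj_projdim k Eg Kf))
  (ptriv_via a b' Pp))) => x /=.
by move: (kE x) => /= ->; rewrite subrK jr.
Qed.

(** The stable inverse [g] of [f] satisfies [g f - 1 = b a] with [a : M -> P],
  so that [(f, a)] is split by [(g, -b)]; its complement is stably trivial. *)
Lemma stable_bijection_factor M N (f : {linear M -> N}) :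
  Gorenstein_projective M -> Gorenstein_projective N -> stable_bijection f ->
  exists (P C : lmodType R) (a : {linear M -> P}) (h : {linear M -> (N * P)%type})
    (c : {linear (N * P)%type -> C}),
    [/\ projective P, projective C, short_exact h c & forall x, h x = (f x, a x)].
Proof.
move=> Mg Ng fb; have [/(_ idfun) [g gP] _] := fb N Ng.
(* Since [f (g f - 1) = (f g - 1) f] is stably trivial, injectivity of the stable bijection
   applies. *)
have : ptriv ((g \o f) \- (idfun : {linear M -> M})).
  apply: (fb M Mg).2; apply: ptriv_eq (ptriv_compr f gP) => x /=.
  by rewrite raddfB.
move=> [P [a [b [Pp ab]]]].
have abE x : b (a x) = g (f x) - x := ab x.
have [h hE] := linear_pair f a.
have [l lE] : exists l : {linear (N * P)%type -> M}, forall x, l x = g x.1 - b x.2.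
  by exists ((g \o fst) \- (b \o snd)).
have lh x : l (h x) = x by rewrite hE lE /= abE opprB addrC subrK.
pose C := sm_type (ker_sub l).
have [|c cE] := @factor_mono _ _ _ _ (\val : {linear C -> (N * P)%type})
    (idfun \- (h \o l)) val_inj.
  by move=> x; apply/(ker_exact l); rewrite raddfB /= lh subrr.
have vE x : val (c x) = x - h (l x) := cE x.
have ci x : c (val x) = x.
  apply: val_inj; rewrite vE; have -> : l (val x) = 0.
    by apply/(ker_exact l); exists x.
  by rewrite raddf0 subr0.
exists P, C, a, h, c; split=> //; last first.
  split=> [x y xy|y|y]; first by rewrite -[x]lh xy lh.
  - split=> [cy|[x <-]]; last by apply: val_inj; rewrite vE lh subrr.
    exists (l y); apply/esym/eqP; rewrite -subr_eq0 -vE cy; exact/eqP/raddf0.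
  - by exists (val y).
apply: ptriv_id_projective.
have [i1 i1E] := linear_pair (idfun : {linear N -> N}) (\0 : {linear N -> P}).
have [i2 i2E] := linear_pair (\0 : {linear P -> N}) (idfun : {linear P -> P}).
have [i3 i3E] := linear_pair (f \o b) (idfun \+ (a \o b)).
(* This is the matrix of [1 - h l]. One summand contains [f g - 1] and the others factor through
   [P], so [e] is stably trivial, and it restricts to the identity on [C]. *)
pose e := ((i1 \o (\- ((f \o g) \- idfun))) \o fst) \+
    ((i3 \o snd) \+ (\- (i2 \o (a \o (g \o fst))))) : {linear (N * P)%type -> _}.
have eE w : e w = w - h (l w).
  case: w => y z; rewrite hE lE /e /= i1E i2E i3E /= !raddfB /=; congr (_, _) => /=.
    by rewrite opprB opprK oppr0 addr0 -addrA addrC addrA.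
  by rewrite add0r opprB addrA.
have pt : ptriv e.
  apply: ptrivD; first exact/ptriv_compr/ptriv_compl/ptrivN.
  apply: ptrivD; first exact: ptriv_via.
  by apply: ptrivN; exact: ptriv_via.
apply: ptriv_eq (ptriv_compr (\val : {linear C -> (N * P)%type}) (ptriv_compl c pt)).
by move=> x; apply: etrans (congr1 c (eE (val x))) _; rewrite -vE !ci.
Qed.

(** Follow [h] by the projection to [N], whose kernel is the projective [P]. *)
Lemma stable_bijection_weq M N (f : {linear M -> N}) :
  Gorenstein_projective M -> Gorenstein_projective N -> stable_bijection f ->
  Mod_weq f.
Proof.
move=> Mg Ng /(stable_bijection_factor Mg Ng) [P [C [a [h [c [Pp Cp hc hE]]]]]].
have [i iE] := linear_pair (\0 : {linear P -> N}) (idfun : {linear P -> P}).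
exists (N * P)%type, h, fst; split=> [x|//|]; first by rewrite /= hE.
  by exists C, c.
exists P, i; split; last exact: projdim0.
split=> [x y|[y z]|y]; first by rewrite !iE => -[].
  by split=> /= [->|[x]]; [exists z; rewrite iE|rewrite iE => -[<-]].
by exists (y, 0).
Qed.

End GorensteinProjective.

(** * The unit of the adjunction between [F] and [U] *)

Section Adjunction.
Variables (k : fieldType) (p : nat) (G : topGroupType).
Variable I : open_pro_p_subgroup p G.

Local Notation X := (compact_ind k I).
Local Notation H := (hecke_ring k I).
Local Notation one := (ind_one k I).

Implicit Types (V W : smooth_rep k G) (M N P : lmodType H).

Lemma actD V g (x y : V) : act g (x + y) = act g x + act g y.
Proof. exact: raddfD. Qed.

Lemma act0 V g : act g (0 : V) = 0.
Proof. exact: raddf0. Qed.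

Lemma rep_hom0 V W (f : rep_hom V W) : f 0 = 0.
Proof. exact: raddf0. Qed.

Lemma frobD V (v w : U_type I V) (x : X) : frob (v + w) x = frob v x + frob w x.
Proof.
suff -> : frob (v + w) = rep_add (frob v) (frob w) by [].
apply: ind_hom_ext; rewrite frob_one /=.
by have /= -> := frob_one v; have /= -> := frob_one w.
Qed.

Lemma frobZ V (h : H) (v : U_type I V) (x : X) :
  frob (h *: v) x = frob v ((h : hecke k I) x).
Proof.
suff -> : frob (h *: v) = rep_comp (frob v) (h : hecke k I) by [].
by apply: ind_hom_ext; rewrite frob_one.
Qed.

(** The elementary tensor of [x] and [m], with [m] first so that it becomes a [G]-morphism in
    [x]. *)
Definition tens_fun M (m : M) (x : X) : F_ob M := tpi [:: (x, m)].

Lemma tens_fun_linear M (m : M) : linear (tens_fun m).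
Proof.
move=> a x y; rewrite -[a *: tens_fun _ _]/(tscale a _) tscaleE tpiD.
by apply: tpiP; exact: TRDl.
Qed.

Lemma tens_fun_act M (m : M) g x : tens_fun m (act g x) = act g (tens_fun m x).
Proof. by rewrite -[RHS]/(tact g _) tactE. Qed.

Definition tens M (m : M) : rep_hom X (F_ob M) :=
  RepHom (tens_fun_linear m) (tens_fun_act m).

Lemma tensD M (m n : M) x : tens (m + n) x = tens m x + tens n x.
Proof. by rewrite tpiD; apply: tpiP; exact: TRDr. Qed.

Lemma tensZ M (h : H) (m : M) x : tens (h *: m) x = tens m ((h : hecke k I) x).
Proof. by apply/esym/tpiP; exact: TRbal. Qed.

Lemma tpi_sum M (s : seq (X * M)) : tpi s = \sum_(u <- s) tens u.2 u.1.
Proof.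
elim: s => [|[x m] s IHs]; first by rewrite big_nil.
by rewrite big_cons -IHs /= tpiD.
Qed.

Lemma tensor_ind M (Q : F_ob M -> Prop) :
  Q 0 -> (forall m x, Q (tens m x)) -> (forall s t, Q s -> Q t -> Q (s + t)) ->
  forall t, Q t.
Proof.
move=> Q0 Qt QD; elim/tensorW => s; rewrite tpi_sum.
by elim/big_rec: _ => // u t _ Qt'; apply: QD.
Qed.

(** Universal property of the tensor product: summing [f] over a word respects each generating
    relation. *)
Lemma tensor_lift M (V : zmodType) (f : X -> M -> V) :
  (forall x y m, f (x + y) m = f x m + f y m) ->
  (forall x m n, f x (m + n) = f x m + f x n) ->
  (forall x (h : H) m, f ((h : hecke k I) x) m = f x (h *: m)) ->
  exists F : F_ob M -> V, (forall m x, F (tens m x) = f x m) /\ {morph F : s t / s + t}.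
Proof.
move=> fDl fDr fb.
have rel s t : tensor_rel s t ->
    \sum_(u <- s) f u.1 u.2 = \sum_(u <- t) f u.1 u.2 :> V.
  elim=> {s t} //=.
  - by move=> s t u _ -> _ ->.
  - by move=> s s' t t' _ e _ e'; rewrite !big_cat /= e e'.
  - by move=> s t; rewrite !big_cat /= addrC.
  - move=> m; rewrite big_seq1 big_nil /=.
    by apply: (addIr (f 0 m)); rewrite -fDl !add0r.
  - by move=> x y m; rewrite big_seq1 big_cons big_seq1 fDl.
  - by move=> x m n; rewrite big_seq1 big_cons big_seq1 fDr.
  - by move=> x h m; rewrite !big_seq1 fb.
pose F (t : F_ob M) := \sum_(u <- repr (t : tensor M)) f u.1 u.2.
have FE (s : seq (X * M)) : F (tpi s) = \sum_(u <- s) f u.1 u.2.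
  by apply: rel; apply: tpi_rel; rewrite /tpi reprK.
exists F; split=> [m x|]; first by rewrite -[tens m x]/(tpi _) FE big_seq1.
elim/tensorW => s; elim/tensorW => t.
by rewrite tpiD !FE big_cat.
Qed.

(** The adjoint transpose of [f]; [frobZ] makes the pairing [(x, m) |-> frob (f m) x] balanced over
    [H]. *)
Lemma F_adjoint M V (f : {linear M -> U_type I V}) :
  exists g : rep_hom (F_ob M) V, forall m x, g (tens m x) = frob (f m) x.
Proof.
have [x y m|x m n|x h m|g [gE gD]] := @tensor_lift M V (fun x m => frob (f m) x).
- by rewrite raddfD.
- by rewrite raddfD frobD.
- by rewrite linearZ_LR frobZ.
have g0 : g 0 = 0 by apply: (addIr (g 0)); rewrite -gD !add0r.
have gZ a t : g (a *: t) = a *: g t.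
  elim/tensor_ind: t => [|m x|s t es et]; first by rewrite scaler0 g0 scaler0.
    by rewrite -rep_homZ !gE rep_homZ.
  by rewrite scalerDr !gD es et scalerDr.
have gl : linear g by move=> a s t; rewrite gD gZ.
have ga h t : g (act h t) = act h (g t).
  elim/tensor_ind: t => [|m x|s t es et]; first by rewrite act0 g0 act0.
    by rewrite -rep_fun_act !gE rep_fun_act.
  by rewrite actD !gD es et actD.
by exists (RepHom gl ga).
Qed.

Lemma F_hom_ext M V (f g : rep_hom (F_ob M) V) :
  (forall m, f (tens m one) = g (tens m one)) -> f =1 g.
Proof.
move=> fg; elim/tensor_ind => [|m x|s t es et]; first by rewrite !rep_hom0.
  suff e : rep_comp f (tens m) = rep_comp g (tens m).
    exact: (congr1 (fun phi : rep_hom _ _ => phi x) e).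
  by apply: ind_hom_ext; exact: fg.
by rewrite !rep_homD es et.
Qed.

Lemma ind_one_inv (i : G) : opp_set I i -> act i (one : X) = one.
Proof.
move=> Ii; apply: val_inj; apply/funext => g; rewrite ind_actE /= /ind_one_fun.
congr (nat_of_bool _)%:R; have [_ IM IV] := opp_subgroup I.
apply: asbool_equiv_eq; split=> [Iig|Ig]; last by apply: IM => //; exact: IV.
by rewrite -(mulVKg i g); apply: IM.
Qed.

Lemma eta_subproof M (m : M) : tens m one \in sm_pred (inv_sub I (F_ob M)).
Proof. by apply/asboolP => i Ii; rewrite -rep_fun_act ind_one_inv. Qed.

(** The unit of the adjunction between [F] and [U]. *)
Definition eta M (m : M) : U_type I (F_ob M) := exist _ (tens m one) (eta_subproof m).

Lemma frob_eta M (m : M) : frob (eta m) = tens m.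
Proof. by apply: ind_hom_ext; rewrite frob_one. Qed.

Lemma eta_linear M : linear (@eta M).
Proof.
move=> h m n; apply: val_inj.
apply: etrans (tensD _ _ _) _; rewrite tensZ.
by have /= <- := congr1 (fun f : rep_hom _ _ => f ((h : hecke k I) one)) (frob_eta m).
Qed.

HB.instance Definition _ M :=
  GRing.isLinear.Build H M (U_type I (F_ob M)) _ (@eta M) (@eta_linear M).

Lemma eta_nat M N (f : {linear M -> N}) m : U_map (F_mor f) (eta m) = eta (f m).
Proof. by apply: val_inj; rewrite /= F_funE. Qed.

(** For [P] a direct summand of a free module with coordinate functions [i s],
  an element [t] of [F P] is determined by its coordinates [th s t] in [X], and
  it is [I]-invariant iff all of them are. *)
Lemma eta_bijective P : projective P -> injective (@eta P) /\ surjective_map (@eta P).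
Proof.
move=> Pp; have [S [i [r [b [ir rE]]]]] := projective_retract_free Pp.
(* A coordinate of [m] is an element of [H], read here as an endomorphism of [X]. *)
pose h (m : P) s : hecke k I := val (i m) s.
have /choice [th thP] s : exists th : F_ob P -> X,
    (forall m x, th (tens m x) = h m s x) /\ {morph th : u v / u + v}.
  apply: tensor_lift => [x y m|x m n|x a m].
  - exact: (rep_homD (h m s)).
  - have e : val (i (m + n)) = val (i m) + val (i n) by rewrite !raddfD.
    exact: (congr1 (fun c : S -> hecke k I => c s x) e).
  - have e : val (i (a *: m)) = a *: val (i m) by rewrite !linearZ_LR.
    exact: esym (congr1 (fun c : S -> hecke k I => c s x) e).
have th_act s g t : th s (act g t) = act g (th s t).
  have th0 : th s 0 = 0 by apply: (addIr (th s 0)); rewrite -(thP s).2 !add0r.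
  elim/tensor_ind: t => [|m x|u v eu ev]; first by rewrite act0 th0 act0.
    by rewrite -rep_fun_act !(thP s).1 rep_fun_act.
  by rewrite actD !(thP s).2 eu ev actD.
split.
  apply: injective_linear => m m0; rewrite -(ir m).
  suff -> : i m = 0 by rewrite raddf0.
  apply: val_inj; apply/funext => s; apply: ind_hom_ext.
  rewrite -[LHS]/(h m s one) -(thP s).1.
  have -> : tens m one = 0 :> F_ob P by rewrite -[LHS]/(val (eta m)) m0.
  by apply: (addIr (th s 0)); rewrite -(thP s).2 !add0r.
(* Allowing every larger list makes it possible to add two expansions over a common list. *)
have expand (t : F_ob P) : exists s : seq S, uniq s /\
    forall s', uniq s' -> {subset s <= s'} ->
    t = \sum_(u <- s') tens (b u) (th u t).
  elim/tensor_ind: t => [|m x|t t' [s [us st]] [s' [us' st']]].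
  - exists [::]; split=> // s' _ _; rewrite big1 // => u _.
    have -> : th u 0 = 0 by apply: (addIr (th u 0)); rewrite -(thP u).2 !add0r.
    exact: raddf0.
  - have [s sP] := dsumP (i m); exists (undup s); split; first exact: undup_uniq.
    move=> s' us' ss'; rewrite -{1}(ir m) (rE (i m) s') //; last first.
      by move=> u us; apply: sP; apply: contra us => us; apply: ss'; rewrite mem_undup.
    have tE c : tens (\sum_(u <- c) (h m u : H) *: b u) x = \sum_(u <- c) tens (b u) (h m u x).
      elim: c => [|u c IHc]; last by rewrite !big_cons tensD tensZ IHc.
      by rewrite !big_nil -[0](scale0r (0 : P)) tensZ; exact: raddf0.
    by rewrite tE; apply: eq_bigr => u _; rewrite (thP u).1.
  - exists (undup (s ++ s')); split; first exact: undup_uniq.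
    move=> s'' us'' ss''; have ss u : u \in s -> u \in s''.
      by move=> us1; apply: ss''; rewrite mem_undup mem_cat us1.
    have ss' u : u \in s' -> u \in s''.
      by move=> us1; apply: ss''; rewrite mem_undup mem_cat us1 orbT.
    apply: etrans (congr2 +%R (st s'' us'' ss) (st' s'' us'' ss')) _.
    by rewrite -big_split; apply: eq_bigr => u _; rewrite (thP u).2 rep_homD.
move=> v; have [s [us sv]] := expand (val v).
have thI u : th u (val v) \in sm_pred (inv_sub I X).
  by apply/asboolP => j Ij; rewrite -th_act invP.
(* By Frobenius reciprocity an [I]-invariant coordinate in [X] is the value at [one] of an element
   of [H]. *)
pose hu u : hecke k I := frob (exist _ (th u (val v)) (thI u)).
exists (\sum_(u <- s) (hu u : H) *: b u); apply: val_inj.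
rewrite [RHS](sv s) // raddf_sum raddf_sum; apply: eq_bigr => u _.
by rewrite [LHS]tensZ /hu frob_one.
Qed.

End Adjunction.

(** * Localizations *)

Section Isomorphisms.
Variables C D : category.

Lemma is_iso_id (x : C) : is_iso (idm x).
Proof. by exists (idm x); split; exact: comp1m. Qed.

Lemma is_iso_comp (x y z : C) (g : hom y z) (f : hom x y) :
  is_iso g -> is_iso f -> is_iso (g \c f).
Proof.
move=> [g' [g'g gg']] [f' [f'f ff']]; exists (f' \c g'); split.
- apply: heq_trans (heq_sym (compA _ _ _)) _.
  apply: heq_trans (comp_heq (heq_refl _) (compA _ _ _)) _.
  apply: heq_trans (comp_heq (heq_refl _) (comp_heq g'g (heq_refl _))) _.
  exact: heq_trans (comp_heq (heq_refl _) (comp1m _)) f'f.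
- apply: heq_trans (heq_sym (compA _ _ _)) _.
  apply: heq_trans (comp_heq (heq_refl _) (compA _ _ _)) _.
  apply: heq_trans (comp_heq (heq_refl _) (comp_heq ff' (heq_refl _))) _.
  exact: heq_trans (comp_heq (heq_refl _) (comp1m _)) gg'.
Qed.

Lemma is_iso_heq (x y : C) (f g : hom x y) : f =h g -> is_iso f -> is_iso g.
Proof.
move=> fg [h [hf fh]]; exists h; split.
  exact: heq_trans (comp_heq (heq_refl _) (heq_sym fg)) hf.
exact: heq_trans (comp_heq (heq_sym fg) (heq_refl _)) fh.
Qed.

Lemma fmap_iso (F : functor C D) (x y : C) (f : hom x y) :
  is_iso f -> is_iso (fmap F f).
Proof.
move=> [g [gf fg]]; exists (fmap F g).
by split; apply: heq_trans (heq_sym (fmapM _ _ _)) _;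
   apply: heq_trans (fmap_heq _ _) (fmap1 _ _).
Qed.

End Isomorphisms.

Section NatIsomorphisms.
Variables C D E : category.

Lemma nat_iso_trans (F F' F'' : functor C D) :
  nat_isomorphic F F' -> nat_isomorphic F' F'' -> nat_isomorphic F F''.
Proof.
move=> [t ti] [u ui].
have nat x y (f : hom x y) :
    (u y \c t y) \c fmap F f =h fmap F'' f \c (u x \c t x).
  apply: heq_trans (heq_sym (compA _ _ _)) _.
  apply: heq_trans (comp_heq (heq_refl _) (nt_nat t f)) _.
  apply: heq_trans (compA _ _ _) _.
  apply: heq_trans (comp_heq (nt_nat u f) (heq_refl _)) _.
  exact: heq_sym (compA _ _ _).
by exists (NatTrans nat) => x; apply: is_iso_comp.
Qed.

Lemma nat_iso_whiskerl (G : functor D E) (F F' : functor C D) :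
  nat_isomorphic F F' -> nat_isomorphic (G \of F) (G \of F').
Proof.
move=> [t ti].
have nat x y (f : hom x y) :
    fmap G (t y) \c fmap (G \of F) f =h fmap (G \of F') f \c fmap G (t x).
  exact: heq_trans (heq_sym (fmapM G (t y) (fmap F f)))
    (heq_trans (fmap_heq G (nt_nat t f)) (fmapM G (fmap F' f) (t x))).
exists (@NatTrans _ _ (G \of F) (G \of F') (fun x => fmap G (t x)) nat) => x.
exact: fmap_iso (ti x).
Qed.

Lemma nat_iso_whiskerr (G G' : functor D E) (F : functor C D) :
  nat_isomorphic G G' -> nat_isomorphic (G \of F) (G' \of F).
Proof.
move=> [t ti].
exists (@NatTrans _ _ (G \of F) (G' \of F) (fun x => t (F x))
  (fun x y f => nt_nat t (fmap F f))) => x.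
exact: ti.
Qed.

End NatIsomorphisms.

(** * Natural transformations out of a localization *)

Section HoNat.
Variables (C D : category) (W : mor_class C).

Lemma Zmor_iso (x y : C) (w : hom x y) : W w -> @is_iso (Ho W) x y (Zmor W w).
Proof. by move=> Ww; exists (Zinv Ww); split; [exact: ZinvK|exact: ZKinv]. Qed.

Lemma Zmor_is_iso (x y : C) (f : hom x y) : is_iso f -> @is_iso (Ho W) x y (Zmor W f).
Proof. exact: (@fmap_iso _ _ (Ho_loc W)). Qed.

Variables (F F' : functor (Ho W) D) (t : forall x : C, hom (F x) (F' x)).
Hypothesis t_nat : forall (x y : C) (f : hom x y),
  t y \c fmap F (Zmor W f : @hom (Ho W) x y)
    =h fmap F' (Zmor W f : @hom (Ho W) x y) \c t x.

(** Induction on zigzags; the square for a formal inverse follows from that of [w] by composing with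
    the inverses of its images. *)
Lemma Ho_natural (x y : Ho W) (a : hom x y) : t y \c fmap F a =h fmap F' a \c t x.
Proof.
elim: a => {x y} [x|x y z b IHb a IHa|x y f|x y w Ww]; last 2 first.
- exact: t_nat.
- pose v : @hom (Ho W) y x := Zinv Ww; pose m : @hom (Ho W) x y := Zmor W w.
  have vm : v \c m =h @idm (Ho W) x by exact: ZinvK.
  have mv : m \c v =h @idm (Ho W) y by exact: ZKinv.
  rewrite -/v.
  apply: heq_trans (heq_sym (comp1m _)) _.
  apply: heq_trans (comp_heq (heq_sym (fmap1 F' x)) (heq_refl _)) _.
  apply: heq_trans (comp_heq (fmap_heq F' (heq_sym vm)) (heq_refl _)) _.
  apply: heq_trans (comp_heq (fmapM F' _ _) (heq_refl _)) _.
  apply: heq_trans (heq_sym (compA _ _ _)) _.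
  apply: comp_heq (heq_refl _) _.
  apply: heq_trans (compA _ _ _) _.
  apply: heq_trans (comp_heq (heq_sym (t_nat w)) (heq_refl _)) _.
  apply: heq_trans (heq_sym (compA _ _ _)) _.
  apply: heq_trans (comp_heq (heq_refl _) (heq_sym (fmapM F _ _))) _.
  apply: heq_trans (comp_heq (heq_refl _) (fmap_heq F mv)) _.
  apply: heq_trans (comp_heq (heq_refl _) (fmap1 F y)) _.
  exact: compm1.
- apply: heq_trans (comp_heq (heq_refl _) (fmap1 F x)) _.
  apply: heq_trans (compm1 _) _.
  apply: heq_trans (heq_sym (comp1m _)) _.
  exact: comp_heq (heq_sym (fmap1 F' x)) (heq_refl _).
- apply: heq_trans (comp_heq (heq_refl _) (fmapM F (b : @hom (Ho W) y z) a)) _.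
  apply: heq_trans (compA _ _ _) _.
  apply: heq_trans (comp_heq IHb (heq_refl _)) _.
  apply: heq_trans (heq_sym (compA _ _ _)) _.
  apply: heq_trans (comp_heq (heq_refl _) IHa) _.
  apply: heq_trans (compA _ _ _) _.
  exact: comp_heq (heq_sym (fmapM F' (b : @hom (Ho W) y z) a)) (heq_refl _).
Qed.

Definition Ho_nat_trans : nat_trans F F' := @NatTrans _ _ F F' t Ho_natural.

Lemma Ho_nat_isomorphic : (forall x, is_iso (t x)) -> nat_isomorphic F F'.
Proof. by move=> ti; exists Ho_nat_trans. Qed.

End HoNat.

(** Both functors are left Kan extensions of [Ho_loc W' \of F]. *)
Lemma right_derived_preserves (C D : category) (W : mor_class C) (W' : mor_class D)
    (F : functor C D) (FW : preserves W W' F) (RF : right_derived_functor W W' F) :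
  nat_isomorphic RF (Ho_functor FW).
Proof.
have snat (x y : C) (f : hom x y) :
    @heq (Ho W') _ _ (Zcomp (Zid W' (F y)) (Zmor W' (fmap F f)))
      (Zcomp (Zmor W' (fmap F f)) (Zid W' (F x))).
  exact: Ztrans (Z1m _) (Zsym (Zm1 _)).
have [th thE] := rdf_exists RF (@NatTrans _ _ (Ho_loc W' \of F)
  (Ho_functor FW \of Ho_loc W) (fun x => Zid W' (F x)) snat).
pose u := @Ho_nat_trans _ _ W (Ho_functor FW) RF (rdf_unit RF) (nt_nat (rdf_unit RF)).
have nat x y (f : @hom (Ho W) x y) :
    (u y \c th y) \c fmap RF f =h fmap RF f \c (u x \c th x).
  apply: heq_trans (heq_sym (compA _ _ _)) _.
  apply: heq_trans (comp_heq (heq_refl _) (nt_nat th f)) _.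
  apply: heq_trans (compA _ _ _) _.
  apply: heq_trans (comp_heq (nt_nat u f) (heq_refl _)) _.
  exact: heq_sym (compA _ _ _).
have idnat x y (f : @hom (Ho W) x y) : idm (RF y) \c fmap RF f =h fmap RF f \c idm (RF x).
  exact: heq_trans (comp1m _) (heq_sym (compm1 _)).
(* Both [u \c th] and the identity of [RF] fix the derived unit, so uniqueness identifies them;
   [th \c u] is the identity by the choice of [th]. *)
have uth := @rdf_unique _ _ _ _ _ RF RF (NatTrans nat) (NatTrans idnat).
exists th => x; exists (u x); split; last exact: heq_sym (thE x).
apply: uth => y; apply: heq_trans (heq_sym (compA (u y) (th y) _)) _.
apply: heq_trans (comp_heq (heq_refl (u y)) (heq_sym (thE y))) _.
exact: Ztrans (Zm1 _) (Zsym (Z1m _)).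
Qed.

(** * The Frobenius category and the functor of [I]-invariants *)

Section RepConstructions.
Variables (k : fieldType) (G : topGroupType).
Implicit Types V W L A : smooth_rep k G.

Lemma rep_factor_mono L A V (j : rep_hom L A) (f : rep_hom V A) :
  injective j -> (forall v, exists l, j l = f v) ->
  exists g : rep_hom V L, forall v, j (g v) = f v.
Proof.
move=> ji /(@factor_mono k L A V j f ji) [g gE].
have ga h v : g (act h v) = act h (g v).
  by apply: ji; rewrite rep_fun_act; move: (gE (act h v)) (gE v) => /= -> ->;
     rewrite rep_fun_act.
have gl : linear g by move=> a x y; exact: linearP.
by exists (RepHom gl ga).
Qed.

Program Definition rep_prod V W : smooth_rep k G :=
  @SmoothRep k G (V * W)%type (fun g v => (act g v.1, act g v.2)) _ _ _ _.
Next Obligation.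
by move=> V W g a [v w] [v' w'] /=; rewrite !linearP.
Qed.
Next Obligation. by move=> V W [v w]; rewrite !act1. Qed.
Next Obligation. by move=> V W g h [v w]; rewrite !actM. Qed.
Next Obligation.
move=> V W [v w] /=.
rewrite [X in open X](_ : _ = [set g | act g v = v] `&` [set g | act g w = w]).
  by apply: openI; exact: act_smooth.
by apply/seteqP; split=> g /= [-> ->].
Qed.

Program Definition rep_fst V W : rep_hom (rep_prod V W) V := @RepHom k G _ _ fst _ _.
Next Obligation. by []. Qed.
Next Obligation. by []. Qed.

Program Definition rep_snd V W : rep_hom (rep_prod V W) W := @RepHom k G _ _ snd _ _.
Next Obligation. by []. Qed.
Next Obligation. by []. Qed.

Program Definition rep_pair A V W (f : rep_hom A V) (g : rep_hom A W) :
  rep_hom A (rep_prod V W) := @RepHom k G _ _ (fun x => (f x, g x)) _ _.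
Next Obligation. by move=> A V W f g a x y /=; rewrite !linearP. Qed.
Next Obligation. by move=> A V W f g h x /=; rewrite !rep_fun_act. Qed.

Program Definition rep_image_incl V W (f : rep_hom V W) :
  rep_hom (rep_image f) W := @RepHom k G _ _ val _ _.
Next Obligation. by move=> V W f a x y; exact: linearP. Qed.
Next Obligation. by []. Qed.

Lemma rep_image_factor V W (f : rep_hom V W) :
  exists c : rep_hom V (rep_image f),
    (forall v, val (c v) = f v) /\ surjective_map c.
Proof.
have [|v|c cE] := @rep_factor_mono _ _ _ (rep_image_incl f) f.
- exact: val_inj.
- have vP : f v \in sm_pred (image_sub f) by apply/asboolP; exists v.
  by exists (exist _ (f v) vP).
exists c; split=> // w; have /asboolP [v _ vE] := valP w; exists v.
by apply: val_inj; rewrite -vE; exact: cE.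
Qed.

Lemma rep_bijective_iso V W (f : rep_hom V W) :
  injective f -> surjective_map f -> @is_iso (Rep k G) V W f.
Proof.
move=> fi fs; have [g gE] := rep_factor_mono (f := rep_id W) fi fs.
by exists g; split=> x /=; [apply: fi|]; exact: gE.
Qed.

End RepConstructions.

(** * The category [C(G)] and full faithfulness of [U] on it *)

Section CG.
Variables (k : fieldType) (p : nat) (G : topGroupType).
Variable I : open_pro_p_subgroup p G.

Local Notation H := (hecke_ring k I).
Implicit Types V W Z : smooth_rep k G.
Implicit Types M N P : lmodType H.

Lemma U_exist V (v : V) : (forall i, opp_set I i -> act i v = v) ->
  exists u : U_type I V, val u = v.
Proof.
move=> vI; have vP : v \in sm_pred (inv_sub I V) by apply/asboolP.
by exists (exist _ v vP).
Qed.

Lemma U_map_inj V W (f : rep_hom V W) : injective f -> injective (U_map (I := I) f).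
Proof. by move=> fi x y /(congr1 val) /= /fi /val_inj. Qed.

Lemma F_I_projective P : projective P -> I_projective I (F_ob P).
Proof. by move=> Pp; exists P; split=> //; exists (rep_id _), (rep_id _). Qed.

(** As [eta] is bijective on [P], the retraction of [F P] onto [V] becomes one of [P] onto the
    invariants of [V]. *)
Lemma I_projective_U V : I_projective I V -> projective (U_type I V).
Proof.
move=> [P [Pp [s [r rs]]]]; have [ei es] := eta_bijective Pp.
have [e [ee ee']] := linear_inverse ei es.
apply: (@retract_projective _ P _ (e \o U_map s) (U_map r \o @eta _ _ _ I P)) => // x.
by rewrite /= ee'; apply: val_inj; exact: rs.
Qed.

(** A morphism out of [F P] is determined by the invariant elements [tens m one]. *)
Lemma I_projective_ext V W (f g : rep_hom V W) : I_projective I V ->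
  (forall v : U_type I V, f (val v) = g (val v)) -> f =1 g.
Proof.
move=> [P [Pp [s [r rs]]]] fg x.
have E : rep_comp f r =1 rep_comp g r.
  by apply: F_hom_ext => m; exact: (fg (U_map r (eta m))).
by move: (E (s x)) => /=; move: (rs x) => /= ->.
Qed.

(** The morphism is an adjoint transpose restricted along [s]; surjectivity of [eta] is what allows
    its values on all invariants to be computed. *)
Lemma I_projective_full V W (al : {linear U_type I V -> U_type I W}) :
  I_projective I V -> exists a : rep_hom V W, U_map a =1 al.
Proof.
move=> [P [Pp [s [r rs]]]]; have [_ es] := eta_bijective Pp.
have [b bE] := F_adjoint (al \o (U_map r \o @eta _ _ _ I P)).
exists (rep_comp b s) => v; apply: val_inj => /=.
have [m mE] := es (U_map s v).
have -> : s (val v) = tens m (ind_one k I) by rewrite -[LHS]/(val (U_map s v)) -mE.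
rewrite bE frob_one /= mE; congr (val (al _)); apply: val_inj; exact: rs.
Qed.

Lemma F_mor_comp M N P (f : {linear M -> N}) (g : {linear N -> P}) t :
  F_mor g (F_mor f t) = F_mor (g \o f) t.
Proof.
exact: esym (fmapM (F_functor k I) (g : @hom (Mod H) N P) (f : @hom (Mod H) M N) t).
Qed.

Lemma F_mor_id M (f : {linear M -> M}) t : f =1 id -> F_mor f t = t.
Proof.
move=> f1; have e : @heq (Mod H) M M f (idm _) by exact: f1.
exact: (heq_trans (fmap_heq (F_functor k I) e) (fmap1 _ _) t).
Qed.

Lemma F_mor0 M N (f : {linear M -> N}) t : f =1 (fun=> 0) -> F_mor f t = 0.
Proof.
move=> f0; have e : @heq (Mod H) M N f (zeromor _ _) by exact: f0.
exact: (heq_trans (fmap_heq (F_functor k I) e) (@F_zeromor k p G I M N) t).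
Qed.

Lemma I_projective_prod V W :
  I_projective I V -> I_projective I W -> I_projective I (rep_prod V W).
Proof.
move=> [P [Pp [s [r rs]]]] [Q [Qp [s' [r' rs']]]].
have [i1 i1E] := linear_pair (idfun : {linear P -> P}) (\0 : {linear P -> Q}).
have [i2 i2E] := linear_pair (\0 : {linear Q -> P}) (idfun : {linear Q -> Q}).
exists ((P * Q)%type : lmodType H); split; first exact: prod_projective.
exists (rep_add (rep_comp (F_mor i1) (rep_comp s (rep_fst V W)))
                (rep_comp (F_mor i2) (rep_comp s' (rep_snd V W)))).
exists (rep_pair (rep_comp r (F_mor fst)) (rep_comp r' (F_mor snd))).
have E1 (t : F_ob P) (u : F_ob Q) : F_mor fst (F_mor i1 t + F_mor i2 u) = t.
  rewrite rep_homD !F_mor_comp F_mor_id => [|x]; last by rewrite /= i1E.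
  by rewrite F_mor0 => [|x]; rewrite /= ?i2E // addr0.
have E2 (t : F_ob P) (u : F_ob Q) : F_mor snd (F_mor i1 t + F_mor i2 u) = u.
  rewrite rep_homD !F_mor_comp F_mor0 => [|x]; last by rewrite /= i1E.
  by rewrite F_mor_id => [|x]; rewrite /= ?i2E // add0r.
move=> [v w]; congr (_, _).
  by apply: etrans (congr1 r (E1 (s v) (s' w))) _; exact: rs.
by apply: etrans (congr1 r' (E2 (s v) (s' w))) _; exact: rs'.
Qed.

Lemma U_zeromor V W :
  fmap (U_functor k I) (@zeromor (Rep k G) V W) =h @zeromor (Mod H) _ _.
Proof. by move=> v; exact: val_inj. Qed.

Lemma in_CG_intro V (X : complex (Rep k G))
    (d : rep_hom (X (0 + 1)) V) (e : rep_hom V (X 0)) :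
  (forall n, I_projective I (X n)) -> (forall n, I_exact I (cd X (n + 1)) (cd X n)) ->
  surjective_map d -> injective e -> (forall x, e (d x) = cd X 0 x) -> in_CG I V.
Proof.
move=> Xp Xe ds ei ed; exists X; split=> //.
have [v|f fE] := @rep_factor_mono _ _ _ _ _ (rep_image_incl (cd X 0)) e val_inj.
  have [x <-] := ds v; rewrite ed; have [c [cE _]] := rep_image_factor (cd X 0).
  by exists (c x); exact: cE.
exists f; apply: rep_bijective_iso => [x y xy|y].
  by apply: ei; rewrite -!fE xy.
have /asboolP [x _ xE] := valP y; exists (d x); apply: val_inj.
by apply: etrans (fE (d x)) _; rewrite ed; exact: xE.
Qed.

Lemma in_CG_elim V : in_CG I V ->
  exists (X : complex (Rep k G)) (d : rep_hom (X (0 + 1)) V) (e : rep_hom V (X 0)),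
  [/\ forall n, I_projective I (X n), forall n, I_exact I (cd X (n + 1)) (cd X n),
      surjective_map d, injective e & forall x, e (d x) = cd X 0 x].
Proof.
move=> [X [Xp Xe [f [g [gf fg]]]]]; have [c [cE cs]] := rep_image_factor (cd X 0).
exists X, (rep_comp g c), (rep_comp (rep_image_incl (cd X 0)) f); split=> //.
- by move=> v; have [x xE] := cs (f v); exists x; rewrite /= xE; exact: gf.
- by move=> x y /= /val_inj xy; rewrite -[x]gf -[y]gf /= xy.
- by move=> x /=; rewrite -cE; congr val; exact: fg.
Qed.

Lemma in_CG_prod V W : in_CG I V -> in_CG I W -> in_CG I (rep_prod V W).
Proof.
move=> /in_CG_elim [X [d [e [Xp Xe ds ei ed]]]].
move=> /in_CG_elim [Y [d' [e' [Yp Ye d's e'i e'd']]]].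
pose D n := rep_pair (rep_comp (cd X n) (rep_fst (X (n + 1)) (Y (n + 1))))
                     (rep_comp (cd Y n) (rep_snd (X (n + 1)) (Y (n + 1)))).
have DD n : @heq (Rep k G) _ _ (rep_comp (D n) (D (n + 1))) (rep_zero _ _).
  by move=> [x y]; congr (_, _); [exact: (cdd X n)|exact: (cdd Y n)].
apply: (@in_CG_intro _ (@Complex (Rep k G) (fun n => rep_prod (X n) (Y n)) D DD)
  (rep_pair (rep_comp d (rep_fst _ _)) (rep_comp d' (rep_snd _ _)))
  (rep_pair (rep_comp e (rep_fst _ _)) (rep_comp e' (rep_snd _ _)))) => /=.
- by move=> n; exact: I_projective_prod.
- move=> n; split; first exact: DD.
  move=> v; split=> [/(congr1 val) Dv|[x <-]].
    have /(Xe n).2 [x xE] : U_map (cd X n) (U_map (rep_fst _ _) v) = 0.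
      by apply: val_inj; exact: (congr1 fst Dv).
    have /(Ye n).2 [y yE] : U_map (cd Y n) (U_map (rep_snd _ _) v) = 0.
      by apply: val_inj; exact: (congr1 snd Dv).
    have [i Ii|z zE] := @U_exist (rep_prod (X (n + 1 + 1)) (Y (n + 1 + 1))) (val x, val y).
      by congr (_, _); exact: invP.
    exists z; apply: val_inj; rewrite /= zE.
    move: (congr1 val xE) (congr1 val yE) => /= -> ->.
    by case: (val v).
  by apply: val_inj; exact: DD.
- by move=> [v w]; have [x <-] := ds v; have [y <-] := d's w; exists (x, y).
- by move=> [v w] [v' w'] [/ei -> /e'i ->].
- by move=> [x y] /=; rewrite ed e'd'.
Qed.

(** [V] is the image of the contractible complex with all terms [V (+) V] and
  all differentials [(v, w) |-> (w, 0)]. *)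
Lemma I_projective_in_CG V : I_projective I V -> in_CG I V.
Proof.
move=> Vp; pose D := rep_pair (rep_snd V V) (rep_zero (rep_prod V V) V).
have DD (n : int) : @heq (Rep k G) _ _ (rep_comp D D) (rep_zero _ _) by [].
apply: (@in_CG_intro _ (@Complex (Rep k G) (fun n => rep_prod V V) (fun n => D) DD)
  (rep_snd V V) (rep_pair (rep_id V) (rep_zero V V))) => /=.
- by move=> n; exact: I_projective_prod.
- move=> n; split; first exact: (DD n).
  move=> v; split=> [Dv|[x <-]]; last exact: val_inj.
    have v0 : (val v).2 = 0 by exact: (congr1 (fun u => (val u).1) Dv).
  have [i Ii|z zE] := @U_exist (rep_prod V V) (0, (val v).1).
    by congr (_, _); [exact: act0|exact: (congr1 fst (invP v Ii))].
  exists z; apply: val_inj; rewrite /= zE /=; move: v0 => /=.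
  by case: (val v) => /= ? ? ->.
- by move=> v; exists (0, v).
- by move=> x y [].
- by [].
Qed.

Hypothesis hH : Gorenstein_ring H.

(** Collects what is needed of a complex presenting [V]. The Gorenstein hypothesis enters through
    exactness of [Hom(U X, P)], which makes [U V] Gorenstein projective and extends maps along
    [U e]. *)
Lemma in_CG_res V : in_CG I V ->
  exists (X1 X0 K : smooth_rep k G) (i : rep_hom K X1) (d : rep_hom X1 V)
    (e : rep_hom V X0),
  [/\ I_projective I X1 /\ I_projective I X0, surjective_map d /\ injective e,
      [/\ in_CG I K, I_exact I i d, injective (U_map (I := I) i)
        & surjective_map (U_map (I := I) d)],
      Gorenstein_projective (U_type I V)
    & forall P (phi : {linear U_type I V -> P}), projective P ->
        exists psi : {linear U_type I X0 -> P}, psi \o U_map e =1 phi].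
Proof.
move=> /in_CG_elim [X [d [e [Xp Xe ds ei ed]]]].
pose Y : complex (Mod H) := @Ch_ob (Rep k G) (Mod H) (U_functor k I) U_zeromor X.
have Ya : acyclic Y by move=> n; exact: (Xe n).2.
have Yp n : projective (Y n) by exact: I_projective_U.
(* Surjectivity of [d] alone does not suffice: an invariant of [V] maps to a cycle in [U (X 0)],
   which is a boundary of invariants by [I]-exactness. *)
have Uds : surjective_map (U_map (I := I) d).
  move=> v; have /(Ya (-1)) [x xE] : cd Y (-1) (U_map e v) = 0.
    apply: val_inj => /=; have [x <-] := ds (val v); rewrite ed; exact: (cdd X (-1) x).
  exists x; apply: val_inj; apply: ei; rewrite /= ed; exact: (congr1 val xE).
have Yed x : U_map e (U_map d x) = cd Y 0 x by apply: val_inj => /=; rewrite ed.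
have YP P : projective P -> hom_exact Y P by exact: Gorenstein_hom_exact.
have dd x : d (cd X (0 + 1) x) = 0.
  by apply: ei; rewrite ed rep_hom0; exact: (cdd X 0 x).
pose K := rep_image (cd X (0 + 1)).
exists (X (0 + 1)), (X 0), K, (rep_image_incl _), d, e; split=> //.
- split=> //; last 2 first.
  + split=> [x|x].
      by have /asboolP [y _ yE] := valP x; rewrite /= -yE; exact: dd.
    split=> [dx|[y <-]].
      have /(Ya 0) [y yE] : cd Y 0 x = 0 by rewrite -Yed dx raddf0.
      have yP : val x \in sm_pred (image_sub (cd X (0 + 1))).
        by apply/asboolP; exists (val y) => //; exact: (congr1 val yE).
      have [j Ij|z zE] := @U_exist K (exist _ (val x) yP).
        by apply: val_inj; exact: invP.
      by exists z; apply: val_inj; rewrite /= zE.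
    apply: val_inj; have /asboolP [z _ zE] := valP (val y).
    by rewrite /= -zE; exact: dd.
  + by apply: U_map_inj; exact: val_inj.
  have [c [cE cs]] := rep_image_factor (cd X (0 + 1)).
  (* The complex [X] shifted by one degree presents [K]. *)
  apply: (@in_CG_intro K (@Complex (Rep k G) (fun n => X (n + 1))
    (fun n => cd X (n + 1)) (fun n => cdd X (n + 1))) c (rep_image_incl _)) => //.
  + by move=> n /=; exact: (Xp (n + 1)).
  + by move=> n; exact: (Xe (n + 1)).
- exists Y; split=> //.
  have [c [cE cs]] := image_factor (cd Y 0).
  have [v|f fE] := @factor_mono _ _ _ _
    (\val : {linear sm_type (image_sub (cd Y 0)) -> Y 0}) (U_map e) val_inj.
    by have [x <-] := Uds v; exists (c x); exact: etrans (cE x) (esym (Yed x)).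
  have fi : injective f.
    by move=> x y xy; apply: (U_map_inj ei); move: (fE x) (fE y) => /= <- <-; rewrite xy.
  have [|g [fg gf]] := linear_inverse fi; last by exists f, g; split.
  move=> y; have [x <-] := cs y; exists (U_map d x); apply: val_inj.
  by apply: etrans (fE _) (etrans (Yed x) _); rewrite cE.
- move=> P phi Pp; have [x|psi psiE] := YP P Pp 0 (phi \o U_map d).
    by rewrite /= (_ : U_map d _ = 0) ?raddf0 //; apply: val_inj; exact: dd.
  exists psi => v; have [x <-] := Uds v; exact: etrans (congr1 psi (Yed x)) (psiE x).
Qed.

Lemma in_CG_U_Gproj V : in_CG I V -> Gorenstein_projective (U_type I V).
Proof. by move=> /in_CG_res [X1 [X0 [K [i [d [e []]]]]]]. Qed.

Lemma in_CG_faithful V W (f g : rep_hom V W) : in_CG I V ->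
  U_map (I := I) f =1 U_map g -> f =1 g.
Proof.
move=> /in_CG_res [X1 [_ [_ [_ [d [_ [[X1p _] [ds _] _ _ _]]]]]]] fg v.
have [x <-] := ds v; suff E : rep_comp f d =1 rep_comp g d by exact: E.
by apply: (I_projective_ext X1p) => u; exact: (congr1 val (fg (U_map d u))).
Qed.

(** Extend [al] to [X0 -> Z0] and lift it to [X1 -> Z1], realize both on representations, and
    restrict the first to the images [V] and [W]. *)
Lemma in_CG_full V W (al : {linear U_type I V -> U_type I W}) :
  in_CG I V -> in_CG I W -> exists g : rep_hom V W, U_map g =1 al.
Proof.
move=> /in_CG_res [X1 [X0 [_ [_ [d [e [[X1p X0p] [ds ei] _ _ ext]]]]]]].
move=> /in_CG_res [Z1 [Z0 [_ [_ [d' [e' [[Z1p Z0p] [d's e'i] [_ _ _ Ud's] _ _]]]]]]].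
have [be beE] := ext _ (U_map e' \o al) (I_projective_U Z0p).
have [b bE] := I_projective_full be X0p.
have [a' a'E] := I_projective_U X1p (al \o U_map d) Ud's.
have [a aE] := I_projective_full a' X1p.
have E : rep_comp b (rep_comp e d) =1 rep_comp e' (rep_comp d' a).
  apply: (I_projective_ext X1p) => u.
  have := congr1 val (etrans (bE (U_map e (U_map d u))) (beE (U_map d u))).
  move=> /= ->; congr (e' _).
  have := congr1 val (a'E u); rewrite /= => <-; congr (d' _).
  exact: esym (congr1 val (aE u)).
have [v|g gE] := rep_factor_mono (f := rep_comp b e) e'i.
  by have [x <-] := ds v; exists (d' (a x)); exact: esym (E x).
exists g => v; apply: val_inj; apply: e'i; rewrite /= gE /=.
exact: (congr1 val (etrans (bE (U_map e v)) (beE v))).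
Qed.

End CG.

(** * Weak equivalences of [C(G)] detected on invariants *)

Section WeakEquivalences.
Variables (k : fieldType) (p : nat) (G : topGroupType).
Variable I : open_pro_p_subgroup p G.
Local Notation H := (hecke_ring k I).
Hypothesis hH : Gorenstein_ring H.
Implicit Types V W : smooth_rep k G.
Implicit Types M N P A B C : lmodType H.

Lemma I_projective_CG_projective V (hV : in_CG I V) :
  I_projective I V -> CG_projective (exist _ V hV : CG k I).
Proof.
move=> Vp x y z i q f [_ _ qs].
have [al alE] := I_projective_U Vp (U_map (f : rep_hom V (sval z))) qs.
have [g gE] := I_projective_full (W := sval y) al Vp.
exists g; apply: (I_projective_ext (W := sval z) Vp) => v.
exact: (congr1 val (etrans (congr1 _ (gE v)) (alE v))).
Qed.

(** The map from [X1] onto [c] is an admissible epimorphism with kernel in [C(G)], so [c] is a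
    retract of the [I]-projective [X1]. *)
Lemma CG_projective_U (c : CG k I) : CG_projective c -> projective (U_type I (sval c)).
Proof.
move=> cp; have [X1 [_ [K [i [d [_ [[X1p _] _ [Kc id ii ds] _ _]]]]]]] :=
  in_CG_res hH (svalP c).
have [s sE] := cp (exist _ K Kc) (exist _ X1 (I_projective_in_CG X1p)) c i d (idm c)
  (And3 id ii ds).
apply: (retract_projective (s := U_map s) (r := U_map d) _ (I_projective_U X1p)) => v.
by apply: val_inj; exact: sE.
Qed.

Lemma CG_weq_U (x y : CG k I) (f : hom x y) :
  CG_weq f -> Mod_weq (U_map (I := I) (f : rep_hom (sval x) (sval y))).
Proof.
move=> [e [j [q [fE [c [r [[[_ jr] ji rs] cp]]] [t [i [[[_ iq] ii qs] tp]]]]]]].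
exists (U_type I (sval e)), (U_map j), (U_map q); split.
- by move=> v; apply: val_inj; exact: fE.
- by exists (U_type I (sval c)), (U_map r); split; last exact: CG_projective_U.
- exists (U_type I (sval t)), (U_map i); split=> //.
  exact/projdim0/CG_projective_U.
Qed.

(** The factorization of [U f] through [U W (+) P] lifts to one of [f] through
  [W (+) F P] because [U] is fully faithful on [C(G)]. *)
Lemma stable_bijection_CG_weq (x y : CG k I) (f : hom x y) :
  stable_bijection (U_map (I := I) (f : rep_hom (sval x) (sval y))) -> CG_weq f.
Proof.
case: x y f => V hV [W hW] /= f fb.
have := stable_bijection_factor (in_CG_U_Gproj hH hV) (in_CG_U_Gproj hH hW) fb.
move=> [P [C [a [h [c [Pp Cp [hi hc cs] hE]]]]]].
have FPp := F_I_projective Pp; have hFP := I_projective_in_CG FPp.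
have FCp := F_I_projective Cp; have hFC := I_projective_in_CG FCp.
have hE' := in_CG_prod hW hFP.
have [etaPi etaPs] := eta_bijective Pp; have [etaCi etaCs] := eta_bijective Cp.
have [ei [eK Ke]] := linear_inverse etaPi etaPs.
have [j2 j2E] := in_CG_full hH (@eta _ _ _ I P \o a) hV hFP.
pose j := rep_pair f j2 : rep_hom V (rep_prod W (F_ob P)).
pose q := rep_fst W (F_ob P).
pose i := rep_pair (rep_zero (F_ob P) W) (rep_id (F_ob P)).
(* Identifies the invariants of [W (+) F P] with [U W (+) P], carrying [U j] to [h]. *)
have [th thE] := linear_pair (U_map (I := I) q)
  (ei \o U_map (I := I) (rep_snd W (F_ob P))).
have [r rE] := in_CG_full hH (@eta _ _ _ I C \o (c \o th)) hE' hFC.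
have thj (v : U_type I V) : th (U_map j v) = h v.
  rewrite thE hE; congr (_, _); first exact: val_inj.
  apply: etrans (eK (a v)); congr (ei _); apply: etrans (j2E v).
  exact: val_inj.
have thi : injective th.
  move=> u v; rewrite !thE => -[uv /(can_inj Ke) uv'].
  apply: val_inj; move: uv (congr1 val uv') => /=.
  by case: (val u) (val v) => [u1 u2] [v1 v2] /= -> ->.
have rj (v : U_type I V) : U_map r (U_map j v) = 0.
  have -> : U_map r (U_map j v) = eta (c (h v)) by rewrite -thj; exact: rE.
  by rewrite (_ : c (h v) = 0) ?raddf0 //; apply/hc; exists v.
exists (exist _ (rep_prod W (F_ob P)) hE'), j, q; split; first by [].
- exists (exist _ (F_ob C) hFC), r; split; last exact: I_projective_CG_projective.
  split; first split.
  + apply: (in_CG_faithful hH (f := rep_comp r j) (g := rep_zero _ _) hV) => v.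
    by apply: val_inj; exact: (congr1 val (rj v)).
  + move=> e; split=> [re|[v <-]]; last exact: rj.
    have /hc [v vE] : c (th e) = 0.
      by apply: (linear_inj0 etaCi); move: (rE e) => /= <-; exact: re.
    by exists v; apply: thi; rewrite -vE; exact: thj.
  + by move=> u v uv; apply: hi; rewrite -!thj; congr (th _); exact: uv.
  + move=> z; have [z' <-] := etaCs z; have [[w m] <-] := cs z'.
    have [g Ig|e eE] := @U_exist _ _ _ I (rep_prod W (F_ob P)) (val w, val (eta m)).
      by congr (_, _); exact: invP.
    exists e; apply: etrans (rE e) _; congr (eta (c _)).
    rewrite thE; congr (_, _); first by apply: val_inj; rewrite /= eE.
    by apply: etrans (eK m); congr (ei _); apply: val_inj; rewrite /= eE.
- exists (exist _ (F_ob P) hFP), i; split; last exact: I_projective_CG_projective.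
  split; first split; first by [].
  + move=> e; split=> [qe|[z <-]]; last exact: val_inj.
    exists (U_map (rep_snd W (F_ob P)) e); apply: val_inj.
    by move: (congr1 val qe) => /=; case: (val e) => /= ? ? ->.
  + by move=> u v /(congr1 val) [/val_inj].
  + move=> w; have [g Ig|e eE] := @U_exist _ _ _ I (rep_prod W (F_ob P)) (val w, 0).
      by congr (_, _); [exact: invP|exact: act0].
    by exists e; apply: val_inj; rewrite /= eE.
Qed.

(** By naturality, [eta] on [B] maps the image of [d] into the invariants of the image of [F d]. *)
Lemma image_unit A B (d : {linear A -> B}) :
  exists b : {linear sm_type (image_sub d) -> U_type I (rep_image (F_mor d))},
    forall y, val (val (b y)) = tens (val y) (ind_one k I).
Proof.
have ii : injective (U_map (I := I) (rep_image_incl (F_mor d))).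
  by apply: U_map_inj; exact: val_inj.
have [y|b bE] := factor_mono
  (f := @eta _ _ _ I B \o (\val : {linear sm_type (image_sub d) -> B})) ii.
  have /asboolP [x _ xE] := valP y; have [c [cE _]] := rep_image_factor (F_mor d).
  exists (U_map c (eta x)); apply: val_inj; rewrite /= cE -xE.
  exact: (congr1 val (eta_nat d x)).
by exists b => y; have := congr1 val (bE y).
Qed.

(** An invariant of the image of [F d] is [eta y] for some [y] in [B]; injectivity of [eta] on [B']
    gives [d' y = 0], so exactness puts [y] in the image of [d]. *)
Lemma image_unit_bijective A B B' (d : {linear A -> B}) (d' : {linear B -> B'})
    (b : {linear sm_type (image_sub d) -> U_type I (rep_image (F_mor d))}) :
  projective B -> projective B' -> exact_at d d' ->
  (forall y, val (val (b y)) = tens (val y) (ind_one k I)) ->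
  injective b /\ surjective_map b.
Proof.
move=> Bp B'p dd' bE; have [Bi Bs] := eta_bijective Bp; have [B'i _] := eta_bijective B'p.
split=> [x y xy|u].
  apply: val_inj; apply: Bi; apply: val_inj.
  by apply: etrans (esym (bE x)) _; rewrite xy; exact: bE.
have [y yE] := Bs (U_map (rep_image_incl (F_mor d)) u).
have : d' y = 0.
  apply: (linear_inj0 B'i); apply: etrans (esym (eta_nat d' y)) _.
  apply: val_inj; apply: etrans (congr1 (fun z => F_mor d' (val z)) yE) _ => /=.
  have /asboolP [w _ <-] := valP (val u); apply: etrans (F_mor_comp d d' w) _.
  by apply: F_mor0 => x /=; apply/dd'; exists x.
move/dd' => [x xE]; have [c [cE _]] := image_factor d; exists (c x).
by apply: val_inj; apply: val_inj; rewrite bE cE xE; exact: (congr1 val yE).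
Qed.

End WeakEquivalences.

(** * The functor [FF] and its invariants *)

Section Resolution.
Variables (k : fieldType) (p : nat) (G : topGroupType).
Variable I : open_pro_p_subgroup p G.
Local Notation H := (hecke_ring k I).
Variable Y : functorial_resolution H.

(** All terms of the resolution of a Gorenstein projective module are projective, so [eta]
    transports its acyclicity to [I]-exactness of its image under [F]. *)
Lemma FF_in_CG (M : GProj H) : in_CG I (FF Y M).
Proof.
have Xp : forall n, projective (Y (sval M) n).
  exact: (fres_gproj Y (sval M)).1 (svalP M).
exists (F_complex k I (Y (sval M))); split.
- by move=> n; exact: F_I_projective (Xp n).
- move=> n; split; first exact: (cdd (F_complex k I (Y (sval M)))).
  have [ei es] := eta_bijective (Xp n).
  move=> v; split=> [|[w <-]]; last first.
    by apply: val_inj; exact: (cdd (F_complex k I (Y (sval M))) n (val w)).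
  have [y <-] := (eta_bijective (Xp (n + 1))).2 v.
  move=> /(etrans (esym (eta_nat (cd (Y (sval M)) n) y))) /(linear_inj0 ei).
  move=> /(@fres_acyclic _ Y (sval M) n y).1 [x <-].
  by exists (eta x); exact: (eta_nat (cd (Y (sval M)) (n + 1)) x).
- by exists (idm _); exact: is_iso_id.
Qed.

(** Since [U F P = P] for projective [P], [U (FF M)] is identified with
  [U (B_0 (F Y^M)) = B_0 Y^M = M]. *)
Lemma U_FF_iso (M : GProj H) :
  exists ka : {linear U_type I (FF Y M) -> sval M},
    [/\ injective ka, surjective_map ka
      & forall (u : U_type I (FF Y M)) (y : sm_type (image_sub (cd (Y (sval M)) 0))),
          val (val u) = tens (val y) (ind_one k I) -> ka u = fres_B0 Y (sval M) y].
Proof.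
have Xp : forall n, projective (Y (sval M) n).
  exact: (fres_gproj Y (sval M)).1 (svalP M).
have [b bE] := image_unit (cd (Y (sval M)) 0).
have [bi bs] := image_unit_bijective (Xp 0) (Xp (-1))
  (@fres_acyclic _ Y (sval M) (-1)) bE.
have [b' [bK b'K]] := linear_inverse bi bs.
have [g [gf fg]] := fres_B0_iso Y (sval M).
pose rho : {linear sm_type (image_sub (cd (Y (sval M)) 0)) -> sval M} :=
  fres_B0 Y (sval M).
exists (rho \o b'); split.
- apply: inj_comp; last exact: can_inj b'K.
  move=> x y xy; apply: etrans (esym (gf x)) _.
  exact: etrans (congr1 (g : {linear _ -> _}) xy) (gf y).
- by move=> m; exists (b (g m)); rewrite /= bK; exact: fg.
- move=> u y uy; rewrite /=; congr (rho _); rewrite -[RHS]bK; congr (b' _).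
  by apply: val_inj; apply: val_inj; rewrite bE.
Qed.

(** Every invariant has the form [y (x) one], on which the hypotheses determine [ka] and [ka'];
    naturality then reduces to that of [fres_B0]. *)
Lemma U_FF_iso_nat (M N : GProj H) (f : hom M N)
    (ka : {linear U_type I (FF Y M) -> sval M})
    (ka' : {linear U_type I (FF Y N) -> sval N}) :
  (forall (u : U_type I (FF Y M)) (y : sm_type (image_sub (cd (Y (sval M)) 0))),
    val (val u) = tens (val y) (ind_one k I) -> ka u = fres_B0 Y (sval M) y) ->
  (forall (u : U_type I (FF Y N)) (y : sm_type (image_sub (cd (Y (sval N)) 0))),
    val (val u) = tens (val y) (ind_one k I) -> ka' u = fres_B0 Y (sval N) y) ->
  forall u, ka' (U_map (fmap (FF Y) f) u) = (f : {linear sval M -> sval N}) (ka u).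
Proof.
move=> kaE ka'E u.
have Xp : forall n, projective (Y (sval M) n).
  exact: (fres_gproj Y (sval M)).1 (svalP M).
have [b bE] := image_unit (cd (Y (sval M)) 0).
have [bi bs] := image_unit_bijective (Xp 0) (Xp (-1))
  (@fres_acyclic _ Y (sval M) (-1)) bE.
have [y <-] := bs u.
rewrite (kaE _ y (bE y)).
apply: etrans (nt_nat (fres_B0 Y) f y).
apply: ka'E.
apply: etrans (congr1 (F_mor (fmap Y f 0)) (bE y)) _.
exact: F_funE.
Qed.

Lemma U_FF_nat_isomorphic : nat_isomorphic (U_functor k I \of FF Y) (GProj_incl H).
Proof.
pose ka (M : GProj H) := cid (U_FF_iso M).
pose t (M : GProj H) : @hom (Mod H) (U_type I (FF Y M)) (sval M) := sval (ka M).
have t_nat (M N : GProj H) (f : hom M N) :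
    t N \c fmap (U_functor k I \of FF Y) f =h fmap (GProj_incl H) f \c t M.
  move=> u; have [_ _ kaM] := svalP (ka M); have [_ _ kaN] := svalP (ka N).
  exact: (@U_FF_iso_nat M N f _ _ kaM kaN u).
exists (@NatTrans _ _ (U_functor k I \of FF Y) (GProj_incl H) t t_nat) => M.
have [kai kas _] := svalP (ka M); have [g [kag gka]] := linear_inverse kai kas.
by exists g.
Qed.

End Resolution.

(** * Preservation of weak equivalences and comparison of the composites *)

Section Preservation.
Variables (k : fieldType) (p : nat) (G : topGroupType).
Variable I : open_pro_p_subgroup p G.
Local Notation H := (hecke_ring k I).
Hypothesis hH : Gorenstein_ring H.

Lemma U_CG_fully_faithful : fully_faithful (U_functor k I \of CG_incl k I).
Proof.
move=> [V hV] [W hW]; split=> [f g fg|al].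
  exact: (@in_CG_faithful _ _ _ I hH V W f g hV fg).
exact: (in_CG_full hH al hV hW).
Qed.

Lemma CG_incl_preserves : preserves (@CG_weq k p G I) (@Rep_weq k p G I) (CG_incl k I).
Proof. by move=> x y w ww; exact: (CG_weq_U hH ww). Qed.

Lemma U_CG_preserves :
  preserves (@CG_weq k p G I) (@Mod_weq H) (U_functor k I \of CG_incl k I).
Proof. by move=> x y w ww; exact: (CG_weq_U hH ww). Qed.

(** In the naturality square of [cofrep_map] the other three sides are stable bijections, hence so
    is [Q f], and its ends are Gorenstein projective. *)
Lemma cofrep_preserves (Q : cofibrant_replacement H) :
  preserves (@Mod_weq H) (@GProj_weq H) Q.
Proof.
move=> M N f fw.
pose cM : {linear sval (Q M) -> M} := cofrep_map Q M.
pose cN : {linear sval (Q N) -> N} := cofrep_map Q N.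
apply: stable_bijection_weq; [exact: (svalP (Q M))|exact: (svalP (Q N))|].
apply: (stable_bijection_cancel (g := cN)).
  exact/weq_stable_bijection/(cofrep_weq Q).
apply: (stable_bijection_eq (f := (f : {linear M -> N}) \o cM)).
  by move=> x; exact: esym (nt_nat (cofrep_map Q) f x).
apply: stable_bijection_comp; apply: weq_stable_bijection => //.
exact: (cofrep_weq Q).
Qed.

Lemma FF_preserves (Y : functorial_resolution H)
    (FF_CG : forall M : GProj H, in_CG I (FF Y M)) :
  preserves (@GProj_weq H) (@CG_weq k p G I) (corestrict FF_CG).
Proof.
have [ka kai] := U_FF_nat_isomorphic Y => M N f fw.
apply: (stable_bijection_CG_weq hH).
apply: (stable_bijection_cancel (g := ka N)); first exact: is_iso_stable_bijection (kai N).
apply: (stable_bijection_eq (f := (f : {linear sval M -> sval N}) \o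
  (ka M : {linear _ -> sval M}))).
  by move=> u; exact: (esym (nt_nat ka f u)).
apply: stable_bijection_comp; first exact: is_iso_stable_bijection (kai M).
exact: weq_stable_bijection fw.
Qed.

(** The composite [U FF Q U V -> Q U V -> U V] is lifted to [C(G)] by fullness of [U], and
    naturality of the lifts follows from faithfulness. *)
Lemma FF_cofrep_U (Q : cofibrant_replacement H) (Y : functorial_resolution H)
    (FF_CG : forall M : GProj H, in_CG I (FF Y M)) :
  exists t : nat_trans (corestrict FF_CG \of (Q \of (U_functor k I \of CG_incl k I)))
      (fid (CG k I)),
    forall V, CG_weq (t V).
Proof.
have [ka kai] := U_FF_nat_isomorphic Y.
pose q V : {linear _ -> _} := cofrep_map Q (U_type I V) \c ka (Q (U_type I V)).
have t (V : CG k I) : {t : rep_hom (FF Y (Q (U_type I (sval V)))) (sval V) |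
    U_map t =1 q (sval V)}.
  by apply: cid; exact: (in_CG_full hH _ (FF_CG _) (svalP V)).
have t_nat (V W : CG k I) (f : hom V W) :
    @heq (Rep k G) _ _
      (rep_comp (sval (t W)) (fmap (FF Y) (fmap Q (fmap (U_functor k I) f))))
      (rep_comp f (sval (t V))).
  apply: (in_CG_faithful hH (FF_CG _)) => u.
  pose g := fmap Q (fmap (U_functor k I) f).
  have e1 := svalP (t W) (U_map (fmap (FF Y) g) u).
  have e2 := congr1 (cofrep_map Q (U_type I (sval W)) : {linear _ -> _}) (nt_nat ka g u).
  have e3 := nt_nat (cofrep_map Q) (fmap (U_functor k I) f)
    ((ka (Q (U_type I (sval V))) : {linear _ -> _}) u).
  have e4 := congr1 (U_map (f : rep_hom (sval V) (sval W))) (svalP (t V) u).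
  apply: val_inj; exact: (congr1 val (etrans (etrans e1 e2) (etrans e3 (esym e4)))).
exists (@NatTrans _ _ (corestrict FF_CG \of (Q \of (U_functor k I \of CG_incl k I)))
  (fid (CG k I)) (fun V => sval (t V)) t_nat) => V.
apply: (stable_bijection_CG_weq hH).
apply: (@stable_bijection_eq _ _ _ (q (sval V))).
  by move=> u; exact: (esym (svalP (t V) u)).
apply: stable_bijection_comp; first exact: is_iso_stable_bijection (kai _).
exact: weq_stable_bijection (cofrep_weq Q _).
Qed.

End Preservation.

Theorem theorem5p11 (k : fieldType) (p : nat) (hp : p \in [pchar k]%R)
    (G : topGroupType) (I : open_pro_p_subgroup p G)
    (hH : Gorenstein_ring (hecke_ring k I))
    (Q : cofibrant_replacement (hecke_ring k I))
    (Y : functorial_resolution (hecke_ring k I))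
    (RU : right_derived_functor (@Rep_weq k p G I)
            (@Mod_weq (hecke_ring k I)) (U_functor k I)) :
  exists (FF_CG : forall M : GProj (hecke_ring k I), in_CG I (FF Y M))
         (hi : preserves (@CG_weq k p G I) (@Rep_weq k p G I) (CG_incl k I))
         (hUi : preserves (@CG_weq k p G I) (@Mod_weq (hecke_ring k I))
                  (U_functor k I \of CG_incl k I))
         (hQ : preserves (@Mod_weq (hecke_ring k I))
                 (@GProj_weq (hecke_ring k I)) Q)
         (hFF : preserves (@GProj_weq (hecke_ring k I)) (@CG_weq k p G I)
                  (corestrict FF_CG)),
    [/\ fully_faithful (U_functor k I \of CG_incl k I),
        nat_isomorphic (RU \of Ho_functor hi) (Ho_functor hUi)
      & equivalence_with_inverse (RU \of Ho_functor hi)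
                                 (Ho_functor hFF \of Ho_functor hQ)].
Proof.
have hi := CG_incl_preserves hH; have hUi := U_CG_preserves hH.
have hQ := cofrep_preserves Q.
have FF_CG := @FF_in_CG k p G I Y; have hFF := FF_preserves hH FF_CG.
exists FF_CG, hi, hUi, hQ, hFF.
have hU : preserves (@Rep_weq k p G I) (@Mod_weq (hecke_ring k I)) (U_functor k I) by [].
have RUi : nat_isomorphic (RU \of Ho_functor hi) (Ho_functor hUi).
  apply: nat_iso_trans (nat_iso_whiskerr _ (right_derived_preserves hU RU)) _.
  (* Both functors act by [U] on objects and on morphisms of [C(G)], so identities suffice. *)
  apply: (@Ho_nat_isomorphic _ _ _ (Ho_functor hU \of Ho_functor hi) (Ho_functor hUi)
    (fun V => Zid (@Mod_weq _) (U_type I (sval V)))) => [V W f|V].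
    exact: Ztrans (Z1m _) (Zsym (Zm1 _)).
  exact: (@is_iso_id (Ho (@Mod_weq _))).
have commute (C : category) (W : mor_class C) (x y z t : C) (f : hom y t) (g : hom x y)
    (f' : hom z t) (g' : hom x z) : f \c g =h f' \c g' ->
    @heq (Ho W) x t (Zcomp (Zmor W f) (Zmor W g)) (Zcomp (Zmor W f') (Zmor W g')).
  by move=> e; exact: Ztrans (Zsym (ZmorM _ _ _)) (Ztrans (Zmor_heq _ e) (ZmorM _ _ _)).
split=> //; first exact: U_CG_fully_faithful.
split.
  apply: nat_iso_trans (nat_iso_whiskerl _ RUi) _.
  have [t tw] := FF_cofrep_U hH Q FF_CG.
  apply: (@Ho_nat_isomorphic (CG k I) _ _
    ((Ho_functor hFF \of Ho_functor hQ) \of Ho_functor hUi) (fid _)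
    (fun V => Zmor (@CG_weq k p G I) (t V))) => [V W f|V].
    exact: commute (nt_nat t f).
  exact: Zmor_iso (tw V).
apply: nat_iso_trans (nat_iso_whiskerr _ RUi) _.
have [ka kai] := U_FF_nat_isomorphic Y.
apply: (@Ho_nat_isomorphic (Mod (hecke_ring k I)) _ _
  (Ho_functor hUi \of (Ho_functor hFF \of Ho_functor hQ)) (fid _)
  (fun M => Zmor (@Mod_weq _) (cofrep_map Q M \c ka (Q M)))) => [M N f|M].
  apply: commute => u.
  have e := congr1 (cofrep_map Q N : {linear _ -> _}) (nt_nat ka (fmap Q f) u).
  exact: etrans e (nt_nat (cofrep_map Q) f ((ka (Q M) : {linear _ -> _}) u)).
(* The map [U FF Q M -> Q M] is an isomorphism of modules, and [Q M -> M] is a weak equivalence. *)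
apply: is_iso_heq (heq_sym (fmapM (Ho_loc (@Mod_weq _)) (cofrep_map Q M) (ka (Q M)))) _.
apply: (is_iso_comp (C := Ho _)); first exact/Zmor_iso/(cofrep_weq Q).
exact: Zmor_is_iso (kai _).
Qed.
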